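(* Let $M>0$ and $X=[0,M]$ with periodic boundary conditions. Let $a,b,c,d\in C^\infty(X)$ be (periodic) functions, and let $L$ be the operator $$Lu:=a(x)u_{xxx}+b(x)u_{xx}+c(x)u_x+d(x)u,$$ viewed as an unbounded linear operator on (complex) $L^2(X)$ with domain $H^3(X)$. Suppose $\inf_{x\in X}a(x)=a_0>0$ and $$\bar\delta:=\frac1M\int_0^M\frac{b(y)}{a(y)}\,dy\neq0.$$ Then there is a sequence $\{\lambda_j\}_{j\in\mathbf N}$ of eigenvalues of $L$ such that $$\lim_{j\to\infty}\,-\bar\delta\,\Re(\lambda_j)=+\infty.$$
   Context: $H^3(X)$ is the Sobolev space of $M$-periodic functions with three derivatives in $L^2$. *)

(* Defs.v *)
From HB Require Import structures.
From mathcomp Require Import all_boot all_order all_algebra.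
From mathcomp Require Import all_classical all_reals all_analysis.
Set Implicit Arguments. Unset Strict Implicit. Unset Printing Implicit Defensive.
Import Order.TTheory GRing.Theory Num.Theory.
Import numFieldNormedType.Exports.
Local Open Scope classical_set_scope.
Local Open Scope ring_scope.

Section Defs.
Variable R : realType.
Notation mu := (@lebesgue_measure R).

Definition Mperiodic (M : R) (f : R -> R) : Prop := forall x, f (x + M) = f x.

Definition Csmooth (f : R -> R) : Prop := forall (n : nat) (x : R), derivable (derive1n n f) x 1.

Definition L2on (M : R) (f : R -> R) : Prop :=
  measurable_fun `[0%R, M] f /\ (\int[mu]_(x in `[0%R, M]) ((f x) ^+ 2)%:E < +oo)%E.

Definition weak_deriv (M : R) (f g : R -> R) : Prop :=
  forall phi : R -> R, Csmooth phi -> Mperiodic M phi ->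
    (\int[mu]_(x in `[0%R, M]) (f x * derive1 phi x)%:E
     = - \int[mu]_(x in `[0%R, M]) (g x * phi x)%:E)%E.

Definition H3_with (M : R) (u u1 u2 u3 : R -> R) : Prop :=
  [/\ [/\ Mperiodic M u, Mperiodic M u1, Mperiodic M u2 & Mperiodic M u3],
      [/\ L2on M u, L2on M u1, L2on M u2 & L2on M u3] &
      [/\ weak_deriv M u u1, weak_deriv M u1 u2 & weak_deriv M u2 u3]].

(* lam = (lam.1 + i lam.2) is an eigenvalue of
   L u = a u''' + b u'' + c u' + d u on complex L^2(X) with domain H^3(X).
   A complex function is represented by its real part ur and imaginary part ui. *)
Definition is_eigenvalue (M : R) (a b c d : R -> R) (lam : R * R) : Prop :=
  exists (ur ur1 ur2 ur3 ui ui1 ui2 ui3 : R -> R),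
    [/\ H3_with M ur ur1 ur2 ur3, H3_with M ui ui1 ui2 ui3,
        ~ {ae mu, forall x, x \in `[0%R, M] -> ur x = 0 /\ ui x = 0} &
        {ae mu, forall x, x \in `[0%R, M] ->
           a x * ur3 x + b x * ur2 x + c x * ur1 x + d x * ur x
             = lam.1 * ur x - lam.2 * ui x /\
           a x * ui3 x + b x * ui2 x + c x * ui1 x + d x * ui x
             = lam.1 * ui x + lam.2 * ur x}].

Definition deltabar (M : R) (a b : R -> R) : R :=
  M^-1 * \int[mu]_(y in `[0%R, M]) (b y / a y).

End Defs.

(* Main.v *)
(* Let [q = a^(1/3)] and [d = q D].  The derivation [d] turns the leading term of
   the operator into [d^3], and a zeroth order gauge factor makes the coefficient of
   [d^2] a constant [beta], of the sign of the mean of [b/a].  Writing the unknown as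
   [exp (i k theta) (1 + z)] with [d theta = 1], [lam = - i k^3 - beta k^2 + m] and
   [y = d z], the eigenvalue equation becomes
     [(d - rp) (d - rm) y = lower order terms],   [rp, rm = k (- 3 i +- sqrt 3) / 2].
   By the maximum principle both factors are invertible on periodic functions with
   inverses of size O(1/k), and the mean of the right-hand side vanishes for exactly
   one [m].  For large [k] this is a contraction for [h = (d - rm) y], with [m = O(k)];
   hence eigenvalues [lam] with [Re lam = - beta k^2 + O(k)], for every large [k] such
   that [exp (i k theta)] is periodic. *)
Require Import Defs.
From HB Require Import structures.
From mathcomp Require Import all_boot all_order all_algebra.
From mathcomp Require Import all_classical all_reals all_analysis.
From mathcomp Require Import measurable_realfun complex ring lra.
Import Order.TTheory GRing.Theory Num.Theory.
Import numFieldNormedType.Exports.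
Local Open Scope classical_set_scope.
Local Open Scope ring_scope.
Import ComplexField.Normc.
Local Open Scope complex_scope.
Set Implicit Arguments.
Unset Strict Implicit.

Local Notation Re := complex.Re.
Local Notation Im := complex.Im.

(** * Real calculus *)

Section RealCalculus.
Variable R : realType.
Implicit Types f g F G : R -> R.
Notation mu := (@lebesgue_measure R).

(** Conjugation by [exp (i k theta)] turns [d^3], up to a constant, into
    [d (d^2 + 3 i k d - 3 k^2)]. The two roots have real parts [+- k sqrt 3 / 2], away from the
    imaginary axis, so these factors never resonate with the period and each inverse gains [1/k].
    The remaining factor [d] has the constants as kernel and cokernel on periodic functions: this is
    the only obstruction, met by normalising [z] to mean zero and by spending [m] on the mean of the
    right-hand side. The gauge is needed because a varying coefficient of [d^2] would be hit by
    [k^2]: the two inverses would only give [h = O(k)] and [y = O(1)], and [z] would not be small.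
    With a constant coefficient the forcing is [O(k)], hence [h = O(1)] and [y, z = O(1/k)]. A
    periodic gauge removes only the oscillating part of [b/a], which is why its mean survives. The
    term [i k^3] of [lam] is imaginary, so [- beta k^2] dominates [Re lam]. *)

Definition deriv_of f f' := forall x, is_derive x (1 : R) f (f' x).

Lemma deriv_of_continuous f f' : deriv_of f f' -> continuous f.
Proof. by move=> df x; apply/differentiable_continuous/derivable1_diffP; case: (df x). Qed.

Lemma deriv_of_eq f f' g' : deriv_of f f' -> f' =1 g' -> deriv_of f g'.
Proof. by move=> df e x; rewrite -e. Qed.

Lemma deriv_of_ext f f' g g' : deriv_of f f' -> f =1 g -> f' =1 g' -> deriv_of g g'.
Proof. by move=> df /funext <- /funext <-. Qed.

Lemma deriv_of_cst (k : R) : deriv_of (fun=> k) (fun=> 0).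
Proof. by move=> x; exact: is_derive_cst. Qed.

Lemma deriv_ofD f f' g g' : deriv_of f f' -> deriv_of g g' ->
  deriv_of (fun x => f x + g x) (fun x => f' x + g' x).
Proof. by move=> df dg x; have := df x; have := dg x => *; exact: is_deriveD. Qed.

Lemma deriv_ofN f f' : deriv_of f f' -> deriv_of (fun x => - f x) (fun x => - f' x).
Proof. by move=> df x; have := df x => *; exact: is_deriveN. Qed.

Lemma deriv_ofB f f' g g' : deriv_of f f' -> deriv_of g g' ->
  deriv_of (fun x => f x - g x) (fun x => f' x - g' x).
Proof. by move=> df dg; apply: deriv_ofD => //; exact: deriv_ofN. Qed.

Lemma deriv_ofM f f' g g' : deriv_of f f' -> deriv_of g g' ->
  deriv_of (fun x => f x * g x) (fun x => f' x * g x + f x * g' x).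
Proof.
move=> df dg x; have := df x; have := dg x => ? ?.
by apply: is_derive_eq; rewrite addrC; congr (_ + _); rewrite mulrC.
Qed.

Lemma deriv_of_comp f f' g g' : deriv_of f f' -> deriv_of g g' ->
  deriv_of (fun x => f (g x)) (fun x => f' (g x) * g' x).
Proof. by move=> df dg x; have := df (g x); have := dg x => *; exact: is_derive1_comp. Qed.

Lemma deriv_of_inv f f' : (forall x, f x != 0) -> deriv_of f f' ->
  deriv_of (fun x => (f x)^-1) (fun x => - f' x * ((f x)^-1 * (f x)^-1)).
Proof.
move=> f0 df x; have := df x => ?; apply: is_derive_eq.
by rewrite /GRing.scale /= expr2 invfM !mulNr mulrC.
Qed.

Lemma deriv_of_mvt f f' a b : deriv_of f f' ->
  exists2 c, `|f b - f a| <= `|f' c| * `|b - a| & (a <= c <= b) || (b <= c <= a).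
Proof.
move=> df; wlog ab : a b / a <= b.
  move=> H; have [|/ltW ba] := leP a b; first exact: H.
  have [c ? ?] := H _ _ ba; exists c; first by rewrite distrC (distrC b).
  by rewrite orbC.
have [|c cab ->] := MVT_segment ab (fun x _ => df x).
  exact/continuous_subspaceT/(deriv_of_continuous df).
by exists c; [rewrite normrM | move: cab; rewrite in_itv /= => ->].
Qed.

Lemma deriv_of0 f a b : deriv_of f (fun=> 0) -> f a = f b.
Proof.
by move=> /(@deriv_of_mvt _ _ a b)[c]; rewrite normr0 mul0r normr_le0 subr_eq0 => /eqP.
Qed.

Lemma deriv_of_unique F G f : deriv_of F f -> deriv_of G f -> F 0 = G 0 -> F =1 G.
Proof.
move=> dF dG e x; apply/eqP; rewrite -subr_eq0; apply/eqP.
rewrite (@deriv_of0 (fun x => F x - G x) x 0); last first.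
  by apply: deriv_of_eq (deriv_ofB dF dG) _ => y; rewrite subrr.
by rewrite e subrr.
Qed.

Lemma continuous_integrable f a b : continuous f ->
  mu.-integrable `[a, b] (EFin \o f).
Proof.
move=> cf; apply: continuous_compact_integrable; first exact: segment_compact.
exact: continuous_subspaceT.
Qed.

Lemma primitive_right f (a : R) : continuous f ->
  exists F : R -> R, forall x : R, a < x -> is_derive x (1 : R) F (f x).
Proof.
move=> cf; exists (fun x => \int[mu]_(t in `[a, x]) f t) => x ax.
have x1 : x < x + 1 by rewrite ltrDl.
have := continuous_FTC1_closed x1 (continuous_integrable a (x+1) cf) ax (cf x).
set F := (F in derivable F); rewrite -/F => -[d e].
by apply: DeriveDef; [exact: d | rewrite -derive1E; exact: e].
Qed.

(** The integral from [- n] has derivative [f] only to the right of [- n]. Normalised to vanish at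
    0, two such integrals agree wherever both are primitives, since their difference has zero
    derivative; so [n] may depend on the point. *)
Lemma primitive_exists f : continuous f -> exists2 F, deriv_of F f & F 0 = 0.
Proof.
move=> cf.
have /choice[F0 dF0] : forall n : nat, exists F : R -> R, forall x : R, - n%:R < x -> is_derive x (1 : R) F (f x).
  by move=> n; exact: primitive_right.
pose F1 n x := F0 n.+1 x - F0 n.+1 0.
have dF1 n (x : R) : - n.+1%:R < x -> is_derive x (1 : R) (F1 n) (f x).
  move=> nx; have := dF0 n.+1 x nx => dF; apply: is_derive_eq; exact: subr0.
have F10 n : F1 n 0 = 0 by rewrite /F1 subrr.
have eqF m n (x : R) : - m.+1%:R < x -> - n.+1%:R < x -> F1 m x = F1 n x.
  move=> mx nx.
  have key (lo hi : R) : lo <= hi -> - m.+1%:R < lo -> - n.+1%:R < lo ->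
      F1 m hi - F1 n hi = F1 m lo - F1 n lo.
    move=> lh ml nl.
    have d (z : R) : lo <= z -> is_derive z (1:R) (fun z => F1 m z - F1 n z) 0.
      move=> lz; have d1 := dF1 m z (lt_le_trans ml lz); have d2 := dF1 n z (lt_le_trans nl lz).
      by rewrite -(subrr (f z)); exact: is_deriveB.
    have [||c _] := @MVT_segment _ (fun z => F1 m z - F1 n z) (fun=> 0) lo hi lh.
    - by move=> z; rewrite in_itv /= => /andP[/ltW /d].
    - apply: derivable_within_continuous => z; rewrite in_itv /= => /andP[/d [] //].
    by move=> /eqP; rewrite mul0r subr_eq0 => /eqP.
  apply/eqP; rewrite -subr_eq0; apply/eqP.
  have [x0|/ltW x0] := leP 0 x.
    by rewrite (key 0 x x0) ?oppr_lt0 ?ltr0n// !F10 subrr.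
  by rewrite -(key x 0 x0)// !F10 subrr.
pose N (x : R) := Num.bound `|x|.
have NP (x : R) : - (N x).+1%:R < x.
  rewrite ltrNl; apply: le_lt_trans (ler_norm _) _; rewrite normrN.
  by apply: (lt_trans (archi_boundP (normr_ge0 x))); rewrite ltr_nat.
exists (fun x => F1 (N x) x); last by rewrite F10.
move=> x; apply: near_eq_is_derive (dF1 (N x) x (NP x)); near=> y.
apply: eqF; last exact: NP.
near: y; apply: lt_nbhsr; exact: NP.
Unshelve. all: by end_near.
Qed.

Lemma integral_primitive f F (M : R) : 0 < M -> continuous f -> deriv_of F f ->
  (\int[mu]_(x in `[0%R, M]) (f x)%:E = (F M - F 0)%:E)%E.
Proof.
move=> M0 cf dF; rewrite (continuous_FTC2 (F := F) M0) ?EFinB//.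
- exact: continuous_subspaceT.
- split.
  + by move=> x _; case: (dF x).
  + exact/cvg_at_right_filter/(deriv_of_continuous dF).
  + exact/cvg_at_left_filter/(deriv_of_continuous dF).
- by move=> x _; rewrite derive1E; case: (dF x).
Qed.

End RealCalculus.

(** * Periodic functions and finite smoothness *)

Section PeriodicSmooth.
Variable R : realType.
Implicit Types f g F G : R -> R.

Lemma deriv_ofS f f' M : deriv_of f f' -> Mperiodic M f -> Mperiodic M f'.
Proof.
move=> df fM x; have [_ <-] := df x.
have sM : deriv_of (fun x : R => x + M) (fun=> 1 + 0).
  by apply: deriv_ofD; [move=> y; exact: is_derive_id | exact: deriv_of_cst].
have [_] := deriv_of_comp df sM x.
rewrite addr0 mulr1 => <-; congr ('D_1 _ x); apply/funext => y; exact: fM.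
Qed.

Lemma Mperiodic_segment (M x : R) : 0 < M ->
  exists2 y, 0 <= y <= M & forall (T : Type) (f : R -> T), (forall x, f (x + M) = f x) -> f x = f y.
Proof.
move=> M0; pose n := Num.floor (x / M).
have nM T (f : R -> T) : (forall x, f (x + M) = f x) -> forall m : nat, forall y, f (y + M *+ m) = f y.
  move=> fM; elim=> [|m IH] y; first by rewrite mulr0n addr0.
  by rewrite mulrS addrA IH fM.
exists (x - M * n%:~R).
  apply/andP; split.
    by rewrite subr_ge0 mulrC -ler_pdivlMr// ge_floor.
  rewrite lerBlDl -{2}(mulr1 M) -mulrDr mulrC -ler_pdivrMr// ltW//.
  by rewrite -[1]/(1%:~R) -intrD floorD1_gt.
move=> T f fM; case: n => m.
  by rewrite -(nM _ _ fM m (x - _)); congr f; rewrite -pmulrn mulr_natr subrK.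
rewrite -(nM _ _ fM m.+1 x); congr f.
by rewrite NegzE mulrNz mulrN opprK -pmulrn mulr_natr.
Qed.

Lemma Mperiodic_max f M : 0 < M -> continuous f -> Mperiodic M f ->
  exists x0, forall x, f x <= f x0.
Proof.
move=> M0 cf fM.
have [x0 _ fx0] := EVT_max (ltW M0) (continuous_subspaceT cf).
exists x0 => x; have [y y01 ->//] := Mperiodic_segment x M0.
by apply: fx0; rewrite in_itv.
Qed.

Lemma deriv_of_max f f' x0 : deriv_of f f' -> (forall x, f x <= f x0) -> f' x0 = 0.
Proof.
move=> df fx0; have [_ <-] := df x0.
have [|||//|_ ->//] := @derive1_at_max R f (x0 - 1) (x0 + 1) x0.
- by lra.
- by move=> t _; case: (df t).
- by rewrite in_itv /=; apply/andP; split; lra.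
Qed.

(** Derivatives are existential witnesses, so that closure under sums, products and inverses is a
    plain induction on [n]. *)
Fixpoint Ck n f : Prop :=
  if n is m.+1 then exists2 f', deriv_of f f' & Ck m f' else continuous f.

Lemma Ck_continuous n f : Ck n f -> continuous f.
Proof. by case: n => //= n [f' /deriv_of_continuous]. Qed.

Lemma CkS n f : Ck n.+1 f -> Ck n f.
Proof.
elim: n f => [|n IH] f; first exact: Ck_continuous.
by move=> [f' df Cf']; exists f' => //; exact: IH.
Qed.

Lemma Ck_cst n (k : R) : Ck n (fun=> k).
Proof.
elim: n k => [|n IH] k /=; first by move=> x; exact: cvg_cst.
by exists (fun=> 0) => //; exact: deriv_of_cst.
Qed.

Lemma CkN n f : Ck n f -> Ck n (fun x => - f x).
Proof.
elim: n f => [|n IH] f /=; first by move=> cf x; apply: cvgN; exact: cf.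
by move=> [f' df Cf']; exists (fun x => - f' x); [exact: deriv_ofN | exact: IH].
Qed.

Lemma CkD n f g : Ck n f -> Ck n g -> Ck n (fun x => f x + g x).
Proof.
elim: n f g => [|n IH] f g /=.
  by move=> cf cg x; apply: cvgD; [exact: cf | exact: cg].
move=> [f' df Cf'] [g' dg Cg']; exists (fun x => f' x + g' x); last exact: IH.
exact: deriv_ofD.
Qed.

Lemma CkM n f g : Ck n f -> Ck n g -> Ck n (fun x => f x * g x).
Proof.
elim: n f g => [|n IH] f g.
  by move=> cf cg x; apply: cvgM; [exact: cf | exact: cg].
move=> Cf Cg; have [f' df Cf'] := Cf; have [g' dg Cg'] := Cg.
exists (fun x => f' x * g x + f x * g' x); first exact: deriv_ofM.
by apply: CkD; apply: IH => //; exact: CkS.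
Qed.

Lemma Ck_inv n f : (forall x, f x != 0) -> Ck n f -> Ck n (fun x => (f x)^-1).
Proof.
move=> f0; elim: n => [|n IH].
  by move=> cf x; apply: cvgV => //; exact: cf.
move=> Cf; have [f' df Cf'] := Cf.
exists (fun x => - f' x * ((f x)^-1 * (f x)^-1)); first exact: deriv_of_inv.
have Ci := IH (CkS Cf).
by apply: CkM; [exact: CkN | exact: CkM].
Qed.

(** Bootstrap: the right-hand side [g f] is as smooth as [f] and [g], so [f] gains one derivative
    per round. It yields the smoothness of the cube root of [a] without a [Ck] rule for
    composition. *)
Lemma Ck_linear_ode n f g : deriv_of f (fun x => g x * f x) -> Ck n g -> Ck n.+1 f.
Proof.
move=> df; elim: n => [|n IH] Cg.
  by exists (fun x => g x * f x) => //; apply: (@CkM 0) => //; exact: deriv_of_continuous df.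
exists (fun x => g x * f x) => //; apply: CkM => //; exact/IH/CkS.
Qed.

Lemma Csmooth_Ck f n : Csmooth f -> Ck n f.
Proof.
move=> sf; suff H m : Ck n (derive1n m f) by exact: (H 0).
elim: n m => [|n IH] m /=.
  by move=> x; apply/differentiable_continuous/derivable1_diffP/sf.
exists (derive1n m.+1 f); last exact: IH.
by move=> x; apply: DeriveDef; [exact: sf | rewrite /= derive1E].
Qed.

End PeriodicSmooth.

(** * Complex-valued functions of a real variable *)

Section ComplexCalculus.
Variable R : realType.
Local Notation C := R[i].
Implicit Types f g F G : R -> C.
Implicit Types z : C.

Lemma cReD z1 z2 : Re (z1 + z2) = Re z1 + Re z2. Proof. by move: z1 z2 => [? ?] [? ?]. Qed.
Lemma cImD z1 z2 : Im (z1 + z2) = Im z1 + Im z2. Proof. by move: z1 z2 => [? ?] [? ?]. Qed.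
Lemma cReN z : Re (- z) = - Re z. Proof. by move: z => [? ?]. Qed.
Lemma cImN z : Im (- z) = - Im z. Proof. by move: z => [? ?]. Qed.
Lemma cReM z1 z2 : Re (z1 * z2) = Re z1 * Re z2 - Im z1 * Im z2.
Proof. by move: z1 z2 => [? ?] [? ?]. Qed.
Lemma cImM z1 z2 : Im (z1 * z2) = Re z1 * Im z2 + Im z1 * Re z2.
Proof. by move: z1 z2 => [? ?] [? ?]. Qed.

Definition ReImE := (cReD, cImD, cReN, cImN, cReM, cImM).

Lemma normc_ge0 z : 0 <= normc z.
Proof. by case: z => a b /=; rewrite sqrtr_ge0. Qed.

Lemma normc_sqr z : normc z ^+ 2 = Re z ^+ 2 + Im z ^+ 2.
Proof. by case: z => a b /=; rewrite sqr_sqrtr// addr_ge0// sqr_ge0. Qed.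

Lemma normc_Re z : `|Re z| <= normc z.
Proof.
by rewrite -(ger0_norm (normc_ge0 z)) -ler_sqr ?nnegrE// !real_normK ?num_real// normc_sqr lerDl sqr_ge0.
Qed.

Lemma normc_Im z : `|Im z| <= normc z.
Proof.
by rewrite -(ger0_norm (normc_ge0 z)) -ler_sqr ?nnegrE// !real_normK ?num_real// normc_sqr lerDr sqr_ge0.
Qed.

Lemma normc_leRI z : normc z <= `|Re z| + `|Im z|.
Proof.
rewrite -ler_sqr ?nnegrE ?addr_ge0 ?normc_ge0// normc_sqr sqrrD !real_normK ?num_real//.
by rewrite -addrA lerD2l lerDr mulrn_wge0// mulr_ge0.
Qed.

Lemma normc_add z1 z2 : normc (z1 + z2) <= normc z1 + normc z2.
Proof. exact: (@le_normcD R z1 z2). Qed.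

Lemma normc_opp z : normc (- z) = normc z.
Proof. exact: (@complex.normcN R z). Qed.

Lemma normc_real (x : R) : normc (x%:C) = `|x|.
Proof. by rewrite /= expr0n /= addr0 sqrtr_sqr. Qed.

Definition ccont f := continuous (fun x => Re (f x)) /\ continuous (fun x => Im (f x)).

Lemma ccont_cst z : ccont (fun=> z).
Proof. by split=> x; exact: cvg_cst. Qed.

Lemma ccont_real (h : R -> R) : continuous h -> ccont (fun x => (h x)%:C).
Proof. by move=> ch; split => // x; exact: cvg_cst. Qed.

Lemma ccontD f g : ccont f -> ccont g -> ccont (fun x => f x + g x).
Proof.
move=> [cf1 cf2] [cg1 cg2]; split=> x.
- by under eq_fun do rewrite cReD; apply: cvgD; [exact: cf1 | exact: cg1].
- by under eq_fun do rewrite cImD; apply: cvgD; [exact: cf2 | exact: cg2].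
Qed.

Lemma ccontN f : ccont f -> ccont (fun x => - f x).
Proof.
move=> [cf1 cf2]; split=> x.
- by under eq_fun do rewrite cReN; apply: cvgN; exact: cf1.
- by under eq_fun do rewrite cImN; apply: cvgN; exact: cf2.
Qed.

Lemma ccontM f g : ccont f -> ccont g -> ccont (fun x => f x * g x).
Proof.
move=> [cf1 cf2] [cg1 cg2]; split=> x.
- under eq_fun do rewrite cReM; apply: cvgB; apply: cvgM;
    by [exact: cf1 | exact: cf2 | exact: cg1 | exact: cg2].
- under eq_fun do rewrite cImM; apply: cvgD; apply: cvgM;
    by [exact: cf1 | exact: cf2 | exact: cg1 | exact: cg2].
Qed.

Definition cderiv f f' :=
  deriv_of (fun x => Re (f x)) (fun x => Re (f' x)) /\
  deriv_of (fun x => Im (f x)) (fun x => Im (f' x)).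

Lemma cderiv_eq f f' g' : cderiv f f' -> f' =1 g' -> cderiv f g'.
Proof. by move=> df /funext <-. Qed.

Lemma cderiv_ccont f f' : cderiv f f' -> ccont f.
Proof. by move=> [/deriv_of_continuous ? /deriv_of_continuous ?]. Qed.

Lemma cderiv_cst z : cderiv (fun=> z) (fun=> 0).
Proof. by split; exact: deriv_of_cst. Qed.

Lemma cderiv_real (h h' : R -> R) : deriv_of h h' ->
  cderiv (fun x => (h x)%:C) (fun x => (h' x)%:C).
Proof. by move=> dh; split => //=; exact: deriv_of_cst. Qed.

Lemma cderivD f f' g g' : cderiv f f' -> cderiv g g' ->
  cderiv (fun x => f x + g x) (fun x => f' x + g' x).
Proof.
move=> [df1 df2] [dg1 dg2]; split.
- by apply: deriv_of_ext (deriv_ofD df1 dg1) _ _ => x; rewrite ReImE.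
- by apply: deriv_of_ext (deriv_ofD df2 dg2) _ _ => x; rewrite ReImE.
Qed.

Lemma cderivM f f' g g' : cderiv f f' -> cderiv g g' ->
  cderiv (fun x => f x * g x) (fun x => f' x * g x + f x * g' x).
Proof.
move=> [df1 df2] [dg1 dg2]; split.
- apply: deriv_of_ext (deriv_ofB (deriv_ofM df1 dg1) (deriv_ofM df2 dg2)) _ _ => x; first by rewrite !ReImE.
  by rewrite !ReImE; ring.
- apply: deriv_of_ext (deriv_ofD (deriv_ofM df1 dg2) (deriv_ofM df2 dg1)) _ _ => x; first by rewrite !ReImE.
  by rewrite !ReImE; ring.
Qed.

Lemma cderivZ z f f' : cderiv f f' -> cderiv (fun x => z * f x) (fun x => z * f' x).
Proof.
move=> df; apply: cderiv_eq (cderivM (cderiv_cst z) df) _ => x.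
by rewrite mul0r add0r.
Qed.

Lemma cderivN f f' : cderiv f f' -> cderiv (fun x => - f x) (fun x => - f' x).
Proof.
move=> /(cderivZ (-1)) df.
have -> : (fun x => - f x) = (fun x => -1 * f x) by apply/funext => x; rewrite mulN1r.
by apply: cderiv_eq df _ => x; rewrite mulN1r.
Qed.

Lemma cderivB f f' g g' : cderiv f f' -> cderiv g g' ->
  cderiv (fun x => f x - g x) (fun x => f' x - g' x).
Proof. by move=> df dg; apply: cderivD => //; exact: cderivN. Qed.

Lemma complex_eq z1 z2 : Re z1 = Re z2 -> Im z1 = Im z2 -> z1 = z2.
Proof. by case: z1 => a b; case: z2 => c d /= -> ->. Qed.

Lemma cderiv0 f x y : cderiv f (fun=> 0) -> f x = f y.
Proof.
move=> [d1 d2]; apply: complex_eq.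
  exact: (deriv_of0 x y d1).
exact: (deriv_of0 x y d2).
Qed.

(** The mean value theorem applies to the real and the imaginary part separately, at different
    points; the factor 2 is the price. *)
Lemma cderiv_mvt f f' K a b : cderiv f f' ->
  (forall x, (a <= x <= b) || (b <= x <= a) -> normc (f' x) <= K) ->
  normc (f b - f a) <= 2 * K * `|b - a|.
Proof.
move=> [d1 d2] fK; apply: le_trans (normc_leRI _) _; rewrite !ReImE.
have [c1 h1 i1] := deriv_of_mvt a b d1; have [c2 h2 i2] := deriv_of_mvt a b d2.
rewrite -mulrA mulr_natl mulr2n; apply: lerD.
  by apply: le_trans h1 _; rewrite ler_wpM2r//; apply: le_trans (normc_Re _) (fK _ i1).
by apply: le_trans h2 _; rewrite ler_wpM2r//; apply: le_trans (normc_Im _) (fK _ i2).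
Qed.

Lemma cprimitive_exists f : ccont f -> exists2 F, cderiv F f & F 0 = 0.
Proof.
move=> [c1 c2]; have [F1 d1 e1] := primitive_exists c1.
have [F2 d2 e2] := primitive_exists c2.
by exists (fun x => F1 x +i* F2 x) => //; rewrite e1 e2.
Qed.

Lemma cderiv_shift f f' M : cderiv f f' -> cderiv (fun x => f (x + M)) (fun x => f' (x + M)).
Proof.
have sM : deriv_of (fun x : R => x + M) (fun=> 1 + 0).
  by apply: deriv_ofD; [move=> y; exact: is_derive_id | exact: deriv_of_cst].
move=> [d1 d2]; split.
- by apply: deriv_of_eq (deriv_of_comp d1 sM) _ => x; rewrite addr0 mulr1.
- by apply: deriv_of_eq (deriv_of_comp d2 sM) _ => x; rewrite addr0 mulr1.
Qed.

Definition cexp z : C := expR (Re z) * cos (Im z) +i* (expR (Re z) * sin (Im z)).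

Lemma cexpD z1 z2 : cexp (z1 + z2) = cexp z1 * cexp z2.
Proof.
by apply: complex_eq; rewrite /cexp !ReImE /= expRD ?cosD ?sinD; ring.
Qed.

Lemma cexp0 : cexp 0 = 1.
Proof. by apply: complex_eq; rewrite /cexp /= expR0 ?cos0 ?sin0 mul1r. Qed.

Lemma cexpNM z : cexp (- z) * cexp z = 1.
Proof. by rewrite -cexpD addNr cexp0. Qed.

Lemma normc_cexp z : normc (cexp z) = expR (Re z).
Proof.
by rewrite /cexp /= !exprMn -mulrDr cos2Dsin2 mulr1 sqrtr_sqr ger0_norm ?expR_ge0.
Qed.

Lemma cexp_neq0 z : cexp z != 0.
Proof.
apply/eqP => e; have := normc_cexp z; rewrite e normc0 => /esym /eqP.
by rewrite gt_eqF// expR_gt0.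
Qed.

Lemma cderiv_cexp f f' : cderiv f f' ->
  cderiv (fun x => cexp (f x)) (fun x => f' x * cexp (f x)).
Proof.
move=> [d1 d2].
have dE := deriv_of_comp (@is_derive_expR R) d1.
have dc := deriv_of_comp (@is_derive_cos R) d2.
have ds := deriv_of_comp (@is_derive_sin R) d2.
split.
- by apply: deriv_of_eq (deriv_ofM dE dc) _ => x; rewrite ReImE /=; ring.
- by apply: deriv_of_eq (deriv_ofM dE ds) _ => x; rewrite ReImE /=; ring.
Qed.

End ComplexCalculus.

(** * Periodic first-order equations for the derivation [q d/dx] *)

Section WeightedDerivation.
Variable R : realType.
Local Notation C := R[i].
Variables (M W : R) (w theta : R -> R).
Hypotheses (M_gt0 : 0 < M) (w_gt0 : forall x, 0 < w x) (w_le : forall x, w x <= W).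
Hypotheses (w_cont : continuous w) (w_per : Mperiodic M w).
Hypotheses (dtheta : deriv_of theta w) (theta0 : theta 0 = 0).
Implicit Types f g F G y z : R -> C.

Local Notation P := (theta M).

Lemma theta_period_gt0 : 0 < P.
Proof.
have [c _] := MVT_segment (ltW M_gt0) (fun x _ => dtheta x)
  (continuous_subspaceT (deriv_of_continuous dtheta)).
by rewrite theta0 !subr0 => ->; exact: mulr_gt0.
Qed.

Lemma thetaDM x : theta (x + M) = theta x + P.
Proof.
have sM : deriv_of (fun x : R => x + M) (fun=> 1 + 0).
  by apply: deriv_ofD; [move=> y; exact: is_derive_id | exact: deriv_of_cst].
have d1 : deriv_of (fun x => theta (x + M)) w.
  by apply: deriv_of_eq (deriv_of_comp dtheta sM) _ => y; rewrite addr0 mulr1 w_per.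
have d2 : deriv_of (fun x => theta x + P) w.
  by apply: deriv_of_eq (deriv_ofD dtheta (deriv_of_cst P)) _ => y; rewrite addr0.
by apply: (deriv_of_unique d1 d2 _ x); rewrite add0r theta0 add0r.
Qed.

(** With [w = 1/q] this says [f1 = q f'], that is, [f1] is the derivative of [f] in the variable
    [theta]. *)
Definition wderiv f f1 := cderiv f (fun x => (w x)%:C * f1 x).

Lemma wderiv_eq f f1 g1 : wderiv f f1 -> f1 =1 g1 -> wderiv f g1.
Proof. by move=> df /funext <-. Qed.

Lemma wderiv_cst (c : C) : wderiv (fun=> c) (fun=> 0).
Proof. by apply: cderiv_eq (cderiv_cst c) _ => x; rewrite mulr0. Qed.

Lemma wderivD f f1 g g1 : wderiv f f1 -> wderiv g g1 ->
  wderiv (fun x => f x + g x) (fun x => f1 x + g1 x).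
Proof. by move=> df dg; apply: cderiv_eq (cderivD df dg) _ => x; rewrite mulrDr. Qed.

Lemma wderivZ c f f1 : wderiv f f1 -> wderiv (fun x => c * f x) (fun x => c * f1 x).
Proof. by move=> df; apply: cderiv_eq (cderivZ c df) _ => x; rewrite mulrCA. Qed.

Lemma wderivB f f1 g g1 : wderiv f f1 -> wderiv g g1 ->
  wderiv (fun x => f x - g x) (fun x => f1 x - g1 x).
Proof. by move=> df dg; apply: cderiv_eq (cderivB df dg) _ => x; rewrite mulrBr. Qed.

Lemma wderivM f f1 g g1 : wderiv f f1 -> wderiv g g1 ->
  wderiv (fun x => f x * g x) (fun x => f1 x * g x + f x * g1 x).
Proof.
move=> df dg; apply: cderiv_eq (cderivM df dg) _ => x.
by ring.
Qed.

Lemma wderiv_theta : wderiv (fun x => (theta x)%:C) (fun=> 1).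
Proof. by apply: cderiv_eq (cderiv_real dtheta) _ => x; rewrite mulr1. Qed.

Lemma wderiv_cexp (r : C) :
  wderiv (fun x => cexp (r * (theta x)%:C)) (fun x => r * cexp (r * (theta x)%:C)).
Proof.
apply: cderiv_eq (cderiv_cexp (wderivZ r wderiv_theta)) _ => x.
by rewrite mulr1 mulrA.
Qed.

Lemma wderiv_primitive f : ccont f -> exists2 F, wderiv F f & F 0 = 0.
Proof. by move=> cf; apply/cprimitive_exists/ccontM => //; exact: ccont_real. Qed.

Definition Per f := ccont f /\ forall x, f (x + M) = f x.

Lemma Per_cst (c : C) : Per (fun=> c).
Proof. by split => //; exact: ccont_cst. Qed.

Lemma PerD f g : Per f -> Per g -> Per (fun x => f x + g x).
Proof. by move=> [cf fM] [cg gM]; split; [exact: ccontD | move=> x; rewrite fM gM]. Qed.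

Lemma PerN f : Per f -> Per (fun x => - f x).
Proof. by move=> [cf fM]; split; [exact: ccontN | move=> x; rewrite fM]. Qed.

Lemma PerM f g : Per f -> Per g -> Per (fun x => f x * g x).
Proof. by move=> [cf fM] [cg gM]; split; [exact: ccontM | move=> x; rewrite fM gM]. Qed.

(** The mean over a period in the variable [theta], whose length is [P]. Stating it through a
    primitive avoids complex integrals. *)
Definition has_wmean f (m : C) := exists2 F, wderiv F f & F M - F 0 = P%:C * m.

Lemma P_neq0 : P%:C != 0 :> C.
Proof. by rewrite eq_complex /= negb_and gt_eqF// theta_period_gt0. Qed.

Lemma has_wmean_exists f : ccont f -> exists m, has_wmean f m.
Proof.
move=> /wderiv_primitive[F dF F0]; exists (P%:C^-1 * F M); exists F => //.
by rewrite F0 subr0 mulVKf// P_neq0.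
Qed.

Lemma has_wmean_primitive f m F : has_wmean f m -> wderiv F f -> F M - F 0 = P%:C * m.
Proof.
move=> [G dG <-] dF.
have d : cderiv (fun x => F x - G x) (fun=> 0).
  by apply: cderiv_eq (cderivB dF dG) _ => x; rewrite subrr.
by rewrite -[F M](subrK (G M)) (cderiv0 M 0 d); ring.
Qed.

Lemma has_wmeanD f m g n : has_wmean f m -> has_wmean g n ->
  has_wmean (fun x => f x + g x) (m + n).
Proof.
move=> [F dF eF] [G dG eG]; exists (fun x => F x + G x); first exact: wderivD.
by rewrite mulrDr -eF -eG opprD addrACA.
Qed.

Lemma has_wmeanZ c f m : has_wmean f m -> has_wmean (fun x => c * f x) (c * m).
Proof.
move=> [F dF eF]; exists (fun x => c * F x); first exact: wderivZ.
by rewrite -mulrBr eF mulrCA.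
Qed.

Lemma has_wmean_eq f m g n : has_wmean f m -> f =1 g -> m = n -> has_wmean g n.
Proof. by move=> h /funext <- <-. Qed.

Lemma has_wmeanB f m g n : has_wmean f m -> has_wmean g n ->
  has_wmean (fun x => f x - g x) (m - n).
Proof.
move=> hf /(has_wmeanZ (-1)) hg.
by apply: has_wmean_eq (has_wmeanD hf hg) _ _ => [x|]; ring.
Qed.

Lemma has_wmean_cst c : has_wmean (fun=> c) c.
Proof.
exists (fun x => c * (theta x)%:C).
  by apply: wderiv_eq (wderivZ c wderiv_theta) _ => x; rewrite mulr1.
by rewrite theta0 mulr0 subr0 mulrC.
Qed.

Lemma has_wmean_le f m K : has_wmean f m -> (forall x, normc (f x) <= K) ->
  normc m <= 2 * (W * K) * M / P.
Proof.
move=> [F dF eF] fK.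
rewrite ler_pdivlMr ?theta_period_gt0//.
have -> : normc m * P = normc (F M - F 0).
  by rewrite eF normcM normc_real gtr0_norm ?theta_period_gt0// mulrC.
rewrite -{2}(gtr0_norm M_gt0) -{2}(subr0 M); apply: (cderiv_mvt dF) => x _.
rewrite normcM normc_real gtr0_norm//; apply: ler_pM => //; first exact/ltW.
exact: normc_ge0.
Qed.

Lemma has_wmean_deriv y f : wderiv y f -> y M = y 0 -> has_wmean f 0.
Proof. by move=> dy e; exists y => //; rewrite e subrr mulr0. Qed.

Lemma Per0M f : Per f -> f M = f 0.
Proof. by move=> [_ /(_ 0)]; rewrite add0r. Qed.

(** Averaging the equation kills both the derivative of [y] and [f], leaving [r] times the mean of
    [y]. *)
Lemma wderiv_mean_zero r y f : r != 0 -> wderiv y (fun x => r * y x + f x) -> Per y ->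
  has_wmean f 0 -> has_wmean y 0.
Proof.
move=> r0 dy py mf.
have h := has_wmeanB (has_wmean_deriv dy (Per0M py)) mf.
apply: has_wmean_eq (has_wmeanZ r^-1 h) _ _ => [x|]; last by rewrite subrr mulr0.
by rewrite addrK mulKf.
Qed.

Lemma wderiv_shift y f : wderiv y f -> wderiv (fun x => y (x + M)) (fun x => f (x + M)).
Proof. by move=> /(cderiv_shift M) dy; apply: cderiv_eq dy _ => x; rewrite w_per. Qed.

Lemma wderiv_linear_unique (r : C) v : wderiv v (fun x => r * v x) -> v 0 = 0 -> forall x, v x = 0.
Proof.
move=> dv v0 x.
have d : cderiv (fun x => cexp (- r * (theta x)%:C) * v x) (fun=> 0).
  apply: cderiv_eq (wderivM (wderiv_cexp (- r)) dv) _ => t.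
  by rewrite mulNr mulNr mulrCA mulrA (mulrC r) -mulrA addNr mulr0.
have := cderiv0 x 0 d; rewrite v0 mulr0 => /eqP.
by rewrite mulf_eq0 (negbTE (cexp_neq0 _)) => /eqP.
Qed.

Lemma wderiv_solve (r : C) f : Re r != 0 -> Per f ->
  exists2 y, Per y & wderiv y (fun x => r * y x + f x).
Proof.
move=> r0 [cf fM].
pose E x := cexp (r * (theta x)%:C).
pose Ei x := cexp (- (r * (theta x)%:C)).
have dEi : wderiv Ei (fun x => - r * Ei x).
  rewrite /Ei; under eq_fun do rewrite -mulNr.
  by apply: wderiv_eq (wderiv_cexp (- r)) _ => x; rewrite -!mulNr.
have dE : wderiv E (fun x => r * E x) := wderiv_cexp r.
have [Phi dPhi Phi0] := wderiv_primitive (ccontM (cderiv_ccont dEi) cf).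
(* The modulus of [E M] is [exp (Re r * P)], which is not 1 because [Re r] and [P] are nonzero. *)
have e1 : 1 - E M != 0.
  rewrite subr_eq0 eq_sym; apply/eqP => /(congr1 (@normc R)).
  rewrite normc_cexp normc1 => /eqP; rewrite cReM /= mulr0 subr0 -expR0 (inj_eq (@expR_inj R)).
  by rewrite mulf_eq0 (negbTE r0) gt_eqF// theta_period_gt0.
(* Variation of constants; [c] solves [y M = y 0], that is, [E M * (c + Phi M) = c]. *)
pose c := E M * Phi M / (1 - E M).
pose y x := E x * (c + Phi x).
have dy : wderiv y (fun x => r * y x + f x).
  apply: wderiv_eq (wderivM dE (wderivD (wderiv_cst c) dPhi)) _ => x.
  rewrite add0r [E x * (_ * _)]mulrA [E x * _]mulrC cexpNM mul1r.
  by rewrite /y mulrA.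
exists y => //; split; first exact: cderiv_ccont dy.
move=> x; apply/eqP; rewrite -subr_eq0; apply/eqP.
(* The defect of periodicity solves the homogeneous equation and vanishes at 0 by the choice of
   [c]. *)
apply: (@wderiv_linear_unique r (fun x => y (x + M) - y x)); last first.
  rewrite add0r /y Phi0 addr0 /E theta0 mulr0 cexp0 mul1r -/(E M) /c.
  by field; rewrite subr_eq0 eq_sym -subr_eq0 -opprB oppr_eq0.
apply: wderiv_eq (wderivB (wderiv_shift dy) dy) _ => t.
by rewrite fM mulrBr; ring.
Qed.

(* At a maximum of [|y|^2] the real part of [conj y * y'] vanishes. *)
Lemma wderiv_bound (r : C) f y K : Re r != 0 -> Per y ->
  wderiv y (fun x => r * y x + f x) -> (forall x, normc (f x) <= K) ->
  forall x, normc (y x) <= 2 * K / `|Re r|.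
Proof.
move=> r0 [cy yM] dy fK.
pose n x := Re (y x) * Re (y x) + Im (y x) * Im (y x).
have nE x : n x = normc (y x) ^+ 2 by rewrite normc_sqr !expr2.
have [d1 d2] := dy.
have dn := deriv_ofD (deriv_ofM d1 d1) (deriv_ofM d2 d2).
have nM : Mperiodic M n by move=> x; rewrite /n yM.
have [x0 max0] := Mperiodic_max M_gt0 (deriv_of_continuous dn) nM.
have := deriv_of_max dn max0; rewrite !ReImE /= => e.
have e2 : Re r * n x0 = - (Re (y x0) * Re (f x0) + Im (y x0) * Im (f x0)).
  have : w x0 * (Re r * n x0 + (Re (y x0) * Re (f x0) + Im (y x0) * Im (f x0))) = 0.
    rewrite /n; move: e; lra.
  by move=> /eqP; rewrite mulf_eq0 gt_eqF//= addr_eq0 => /eqP.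
have K0 : 0 <= K := le_trans (normc_ge0 _) (fK 0).
have rp : 0 < `|Re r| by rewrite normr_gt0.
have b : `|Re r| * normc (y x0) ^+ 2 <= normc (y x0) * (2 * K).
  rewrite -(ger0_norm (sqr_ge0 (normc (y x0)))) -normrM -nE e2 normrN.
  apply: le_trans (ler_normD _ _) _; rewrite !normrM mulrCA mulr_natl mulr2n.
  by apply: lerD; apply: ler_pM => //; rewrite ?normc_Re ?normc_Im//;
    apply: le_trans (fK x0); rewrite ?normc_Re ?normc_Im.
have b2 : normc (y x0) <= 2 * K / `|Re r|.
  rewrite ler_pdivlMr//; have := normc_ge0 (y x0); rewrite le_eqVlt => /predU1P[<-|yp].
    by rewrite mul0r mulr_ge0.
  by rewrite -(ler_pM2l yp) mulrA -expr2 mulrC.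
move=> x; apply: le_trans b2.
by rewrite -ler_sqr ?nnegrE ?normc_ge0// -!nE; exact: max0.
Qed.

(** The resonant case [r = 0]: a primitive is periodic because [f] has mean zero, and the free
    constant is used to make its own mean vanish. *)
Lemma wderiv0_solve f : Per f -> has_wmean f 0 ->
  exists z, [/\ Per z, wderiv z f & has_wmean z 0].
Proof.
move=> [cf fM] mf; have [F dF F0] := wderiv_primitive cf.
have [m hm] := has_wmean_exists (cderiv_ccont dF).
have dz : wderiv (fun x => F x - m) f.
  by apply: wderiv_eq (wderivB dF (wderiv_cst m)) _ => x; rewrite subr0.
exists (fun x => F x - m); split => //.
- split; first exact: cderiv_ccont dz.
  move=> x; congr (_ - _); apply/eqP; rewrite -subr_eq0; apply/eqP.
  have d : cderiv (fun x => F (x + M) - F x) (fun=> 0).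
    apply: cderiv_eq (wderivB (wderiv_shift dF) dF) _ => t.
    by rewrite fM subrr mulr0.
  by rewrite (cderiv0 x 0 d) add0r (has_wmean_primitive mf dF) mulr0.
- by apply: has_wmean_eq (has_wmeanB hm (has_wmean_cst m)) _ _ => //; rewrite subrr.
Qed.

(** The factor [2 W M] bounds [z - z 0] by the mean value inequality. Since [z] has mean zero,
    [- z 0] is the mean of [z - z 0], which costs the further factor [2 W M / P] of
    [has_wmean_le]. *)
Definition wbound0 := (1 + 2 * W * M / P) * (2 * W * M).

Lemma wderiv0_bound z f K : Per z -> wderiv z f -> has_wmean z 0 ->
  (forall x, normc (f x) <= K) -> forall x, normc (z x) <= wbound0 * K.
Proof.
move=> [cz zM] dz mz fK.
have b x : normc (z x - z 0) <= 2 * W * M * K.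
  have [t t01 e] := Mperiodic_segment x M_gt0; rewrite (e _ _ zM).
  case/andP: t01 => t0 tM.
  have h : forall s, normc ((w s)%:C * f s) <= W * K.
    move=> s; rewrite normcM normc_real gtr0_norm//; apply: ler_pM => //; first exact/ltW.
    exact: normc_ge0.
  apply: le_trans (cderiv_mvt dz (fun s _ => h s)) _.
  rewrite subr0 ger0_norm// mulrA -mulrA [_ * M * K]mulrAC -mulrA.
  have WK : 0 <= W * K by apply: le_trans (h 0); exact: normc_ge0.
  by rewrite -!mulrA ler_pM2l// [K * M]mulrC mulrA mulrA [W * M * _]mulrAC ler_wpM2l// mulrC.
have m0 : has_wmean (fun x => z x - z 0) (- z 0).
  by apply: has_wmean_eq (has_wmeanB mz (has_wmean_cst (z 0))) _ _ => //; rewrite sub0r.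
have b0 := has_wmean_le m0 b; rewrite normc_opp in b0.
move=> x; rewrite -[z x](subrK (z 0)); apply: le_trans (normc_add _ _) _.
apply: le_trans (lerD (b x) b0) _; rewrite le_eqVlt; apply/orP; left; apply/eqP.
by rewrite /wbound0; field; rewrite gt_eqF// theta_period_gt0.
Qed.

End WeightedDerivation.

(** * The fixed point argument *)

Section Contraction.
Variable R : realType.
Local Notation C := R[i].

Lemma le_add_geometric (A x y : R) : (forall n, x <= y + A / 2 ^+ n) -> x <= y.
Proof.
move=> H; rewrite leNgt; apply/negP => yx.
have e0 : 0 < x - y by rewrite subr_gt0.
pose n := Num.bound (`|A| / (x - y)).
have := H n; rewrite -lerBlDl leNgt => /negP; apply.
rewrite ltr_pdivrMr ?exprn_gt0//; apply: le_lt_trans (ler_norm _) _.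
rewrite mulrC -ltr_pdivrMr//; apply: lt_trans (archi_boundP _) _.
  by rewrite divr_ge0// ltW.
by rewrite -/n -natrX ltr_nat ltn_expl.
Qed.

(** With [e n] the sum of the remaining increments, the intervals from [a n - e n] to [a n + e n]
    are nested; the supremum of the left ends lies in all of them. *)
Lemma geometric_cauchy (A : R) (a : nat -> R) :
  (forall n, `|a n.+1 - a n| <= A / 2 ^+ n) ->
  exists l, forall n, `|a n - l| <= 2 * A / 2 ^+ n.
Proof.
move=> aA; pose e n : R := 2 * A / 2 ^+ n.
have eS n : e n.+1 = e n - A / 2 ^+ n.
  by rewrite /e exprS; field; rewrite expf_neq0.
have A0 : 0 <= A by have := aA 0%N; rewrite expr0 divr1; exact: le_trans.
have e0 n : 0 <= e n by rewrite divr_ge0 ?exprn_ge0// mulr_ge0.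
have aS n : a n.+1 - a n <= A / 2 ^+ n /\ - (A / 2 ^+ n) <= a n.+1 - a n.
  by have := aA n; rewrite ler_norml => /andP[].
have dec n m : a (n + m)%N + e (n + m)%N <= a n + e n.
  elim: m => [|m IH]; first by rewrite addn0.
  by apply: le_trans IH; rewrite addnS eS; have [h _] := aS (n + m)%N; lra.
have inc n m : a n - e n <= a (n + m)%N - e (n + m)%N.
  elim: m => [|m IH]; first by rewrite addn0.
  by apply: (le_trans IH); rewrite addnS eS; have [_ h] := aS (n + m)%N; lra.
have cross n m : a m - e m <= a n + e n.
  have := inc m n; have := dec n m; rewrite addnC; have := e0 (m + n)%N; lra.
pose S := range (fun m => a m - e m).
have Sub n : ubound S (a n + e n) by move=> _ [m _ <-]; exact: cross.
exists (sup S) => n; rewrite -/(e n) ler_norml.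
have l1 : sup S <= a n + e n by apply: ge_sup; [exists (a 0%N - e 0%N), 0%N | exact: Sub].
have l2 : a n - e n <= sup S.
  by apply: ub_le_sup; [exists (a 0%N + e 0%N); exact: Sub | exists n].
by apply/andP; split; lra.
Qed.

(** Banach's theorem for a relation [S], because one step is known only through existence
    statements. Single-valuedness on the ball is implicit in the contraction hypothesis with
    [e = 0]. The sup norm appears as a pointwise bound, and completeness as closure of [X] under
    uniform geometric limits. *)
Lemma relational_fixed_point (X : (R -> C) -> Prop) (S : (R -> C) -> (R -> C) -> Prop) (K : R)
    (h0 : R -> C) :
  let B h := X h /\ forall x, normc (h x) <= K in
  B h0 ->
  (forall h, B h -> exists2 h', B h' & S h h') ->
  (forall h1 h1' h2 h2' e, B h1 -> B h2 -> S h1 h1' -> S h2 h2' ->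
     (forall x, normc (h1 x - h2 x) <= e) -> forall x, normc (h1' x - h2' x) <= e / 2) ->
  (forall (u : nat -> R -> C) h A, (forall n, X (u n)) ->
     (forall n x, normc (u n x - h x) <= A / 2 ^+ n) -> X h) ->
  exists2 h, B h & S h h.
Proof.
move=> B Bh0 total lip closedX.
have /choice[T TP] : forall h, exists h', B h -> B h' /\ S h h'.
  (* Off the ball the value [h] is a placeholder; the iterates never leave [B]. *)
  move=> h; have [Bh|nB] := pselect (B h); last by exists h.
  by have [h' ? ?] := total h Bh; exists h'.
pose u n := iter n T h0.
have Bu n : B (u n) by elim: n => //= n /TP[].
have Su n : S (u n) (u n.+1) by have [] := TP _ (Bu n).
have du n x : normc (u n.+1 x - u n x) <= 2 * K / 2 ^+ n.
  elim: n x => [|n IH] x.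
    rewrite expr0 divr1; apply: le_trans (normc_add _ _) _; rewrite normc_opp.
    by rewrite mulr_natl mulr2n; apply: lerD; [have [_] := Bu 1%N|have [_] := Bu 0%N].
  apply: le_trans (lip _ _ _ _ _ (Bu _) (Bu _) (Su _) (Su _) IH x) _.
  rewrite exprS le_eqVlt; apply/orP; left; apply/eqP; field.
  by rewrite expf_neq0.
(* The first increment is at most [2 K], so each of the two real limits is approached within
   [4 K / 2 ^+ n]; together they give [8 K]. *)
have /choice[h hP] : forall x, exists l : C, forall n, normc (u n x - l) <= 8 * K / 2 ^+ n.
  move=> x.
  have [n|l1 h1] := @geometric_cauchy (2 * K) (fun n => Re (u n x)).
    by apply: le_trans (du n x); apply: le_trans (normc_Re _); rewrite !ReImE.
  have [n|l2 h2] := @geometric_cauchy (2 * K) (fun n => Im (u n x)).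
    by apply: le_trans (du n x); apply: le_trans (normc_Im _); rewrite !ReImE.
  exists (l1 +i* l2) => n; apply: le_trans (normc_leRI _) _; rewrite !ReImE /=.
  apply: le_trans (lerD (h1 n) (h2 n)) _; rewrite -mulrDl.
  by have -> : 2 * (2 * K) + 2 * (2 * K) = 8 * K by ring.
have Bh : B h.
  split.
    by apply: (closedX u h (8 * K)) => [n|n x]; [have [] := Bu n | exact: hP].
  move=> x; apply: (@le_add_geometric (8 * K)) => n.
  rewrite -[h x](subKr (u n x)); apply: le_trans (normc_add _ _) _.
  by apply: lerD; [have [_] := Bu n | rewrite normc_opp].
have [_ ShT] := TP _ Bh.
suff e : T h = h by exists h => //; rewrite -{2}e.
apply/funext => x; apply/eqP; rewrite -subr_eq0; apply/eqP/eq0_normc/eqP.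
rewrite eq_le normc_ge0 andbT; apply: (@le_add_geometric (8 * K)) => n; rewrite add0r.
have l := lip _ _ _ _ _ (Bu n) Bh (Su n) ShT (hP^~ n) x.
have -> : T h x - h x = - (u n.+1 x - T h x) + (u n.+1 x - h x) by ring.
apply: le_trans (normc_add _ _) _; rewrite normc_opp.
apply: le_trans (lerD l (hP x n.+1)) _.
rewrite exprS le_eqVlt; apply/orP; left; apply/eqP; field.
by rewrite expf_neq0.
Qed.

Lemma geometric_limit_continuous (u : nat -> R -> R) (f : R -> R) A :
  (forall n, continuous (u n)) -> (forall n x, `|u n x - f x| <= A / 2 ^+ n) -> continuous f.
Proof.
move=> cu uf x; apply/cvgrPdist_le => /= e e0.
have [n hn] : exists n, A / 2 ^+ n <= e / 3.
  apply/not_existsP => H.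
  have : e / 3 <= 0 by apply: (@le_add_geometric A) => n; rewrite add0r ltW// ltNge; apply/negP/H.
  by rewrite leNgt divr_gt0.
have := cu n x => /cvgrPdist_le /(_ (e / 3)); rewrite divr_gt0// => /(_ isT).
apply: filterS => t ht.
have -> : f x - f t = - (u n x - f x) + (u n x - u n t) + (u n t - f t) by ring.
apply: le_trans (ler_normD _ _) _; apply: le_trans (lerD (ler_normD _ _) (lexx _)) _.
rewrite normrN.
have := uf n x; have := uf n t; move: ht hn.
rewrite /=; lra.
Qed.

End Contraction.

Section NormBounds.
Variable R : realType.
Implicit Types u v : R[i].

Lemma normc_leD u v a b : normc u <= a -> normc v <= b -> normc (u + v) <= a + b.
Proof. by move=> ua vb; apply: le_trans (normc_add _ _) (lerD ua vb). Qed.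

Lemma normc_leB u v a b : normc u <= a -> normc v <= b -> normc (u - v) <= a + b.
Proof. by move=> ua vb; apply: normc_leD => //; rewrite normc_opp. Qed.

Lemma normc_leM u v a b : normc u <= a -> normc v <= b -> normc (u * v) <= a * b.
Proof. by move=> ua vb; rewrite normcM; apply: ler_pM => //; exact: normc_ge0. Qed.

End NormBounds.

(** * The iteration at a fixed frequency and its estimates *)

Section Perturbation.
Variable R : realType.
Local Notation C := R[i].
Variables (M W : R) (w theta : R -> R).
Hypotheses (M_gt0 : 0 < M) (w_gt0 : forall x, 0 < w x) (w_le : forall x, w x <= W).
Hypotheses (w_cont : continuous w) (w_per : Mperiodic M w).
Hypotheses (dtheta : deriv_of theta w) (theta0 : theta 0 = 0).
Local Notation P := (theta M).
Local Notation wderiv := (wderiv w).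
Local Notation has_wmean := (has_wmean M w theta).
Local Notation Per := (Per M).

Lemma mean_zero_closed (u : nat -> R -> C) h A :
  (forall n, Per (u n) /\ has_wmean (u n) 0) ->
  (forall n x, normc (u n x - h x) <= A / 2 ^+ n) -> Per h /\ has_wmean h 0.
Proof.
move=> Xu uh.
have Ph : Per h.
  split; first split.
  - apply: (@geometric_limit_continuous _ (fun n x => Re (u n x)) _ A) => [n|n x].
      by have [[[]]] := Xu n.
    by apply: le_trans (uh n x); apply: le_trans (normc_Re _); rewrite !ReImE.
  - apply: (@geometric_limit_continuous _ (fun n x => Im (u n x)) _ A) => [n|n x].
      by have [[[]]] := Xu n.
    by apply: le_trans (uh n x); apply: le_trans (normc_Im _); rewrite !ReImE.
  move=> x; apply/eqP; rewrite -subr_eq0; apply/eqP/eq0_normc/eqP.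
  rewrite eq_le normc_ge0 andbT; apply: (@le_add_geometric _ (2 * A)) => n; rewrite add0r.
  have [[_ uM] _] := Xu n.
  have -> : h (x + M) - h x = (u n x - h x) - (u n (x + M) - h (x + M)) by rewrite uM; ring.
  by apply: le_trans (normc_leB (uh n x) (uh n (x + M))) _; rewrite -mulrDl -mulr2n mulr_natl.
split => //; have [m hm] := has_wmean_exists M_gt0 w_gt0 w_cont dtheta theta0 Ph.1.
suff -> : (0 : C) = m by [].
apply/esym/eq0_normc/eqP; rewrite eq_le normc_ge0 andbT.
apply: (@le_add_geometric _ (2 * (W * A) * M / P)) => n; rewrite add0r.
have := has_wmean_le M_gt0 w_gt0 w_le dtheta theta0 (has_wmeanB (Xu n).2 hm) (uh n).
rewrite sub0r normc_opp => /le_trans; apply.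
by rewrite le_eqVlt; apply/orP; left; apply/eqP; rewrite !mulrA; ring.
Qed.

Variables (Cc Dc : R -> C) (beta B : R).
Hypotheses (PC : Per Cc) (PD : Per Dc).
Hypotheses (C_le : forall x, normc (Cc x) <= B) (D_le : forall x, normc (Dc x) <= B).
Hypotheses (beta_le : `|beta| <= B).

Definition halfsqrt3 : R := Num.sqrt 3 / 2.
Local Notation sg := halfsqrt3.

Lemma halfsqrt3_sqr : sg ^+ 2 = 3 / 4.
Proof. by rewrite /halfsqrt3 expr_div_n sqr_sqrtr//; field. Qed.

Lemma halfsqrt3_itv : 1 / 2 <= sg <= 1.
Proof.
have s0 : 0 <= sg by rewrite divr_ge0.
have := halfsqrt3_sqr; rewrite expr2 => e; apply/andP; split; nra.
Qed.

Definition wbound1 := 2 * W * M / P.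

Section Frequency.
Variable k : R.
Hypothesis k_ge1 : 1 <= k.

(* The roots of [r^2 + 3 i k r - 3 k^2]: conjugating [d^3] by [exp (i k theta)] and
   dividing by [d] leaves [d^2 + 3 i k d - 3 k^2]. *)
Definition rootp : C := (k * sg) +i* (- (3 / 2) * k).
Definition rootm : C := (- (k * sg)) +i* (- (3 / 2) * k).

Lemma rootsD : rootp + rootm = - 3 * ('i * k%:C).
Proof. by apply: complex_eq; rewrite !ReImE /=; field. Qed.

Lemma rootsM : rootp * rootm = - 3 * (k%:C * k%:C).
Proof.
apply: complex_eq; rewrite !ReImE /=; last by ring.
have := halfsqrt3_sqr; rewrite expr2 => e.
transitivity (- (k * k) * (sg * sg) - (9 / 4) * (k * k)); first by field.
by rewrite e; field.
Qed.

(** On [1 + z], the conjugated term [beta (d + i k)^2] gives [beta (d y) + 2 i k beta y - beta k^2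
    (1 + z)]. With [d y = rootm y + h], the terms in [y] collect into [kappa * y]. *)
Definition kappa : C := beta%:C * rootm + 2 * 'i * beta%:C * k%:C.
(* With [m] the mean of [source y z], the forcing has mean zero. *)
Definition source (y z : R -> C) x : C :=
  Cc x * y x + ('i * k%:C * Cc x + Dc x) * (1 + z x).
Definition forcing (h y z : R -> C) (m : C) x : C :=
  - (beta%:C * h x) - kappa * y x - source y z x + m * (1 + z x).

(** The intermediate [y], [z], [m] are exposed because at a fixed point [h' = h] they supply the
    eigenfunction and the correction of the eigenvalue. *)
Definition step_with (h h' y z : R -> C) (m : C) : Prop :=
  [/\ Per y, Per z, wderiv y (fun x => rootm * y x + h x), wderiv z y &
   [/\ has_wmean z 0, has_wmean (source y z) m, Per h' &
       wderiv h' (fun x => rootp * h' x + forcing h y z m x)]].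

Definition step h h' : Prop := exists y z m, step_with h h' y z m.

Let k_gt0 : 0 < k. Proof. exact: lt_le_trans k_ge1. Qed.

Let sg_gt0 : 0 < sg.
Proof. by have /andP[h _] := halfsqrt3_itv; apply: lt_le_trans h; rewrite divr_gt0. Qed.

Lemma Re_rootp : `|Re rootp| = k * sg.
Proof. by rewrite /= gtr0_norm// mulr_gt0. Qed.

Lemma Re_rootm : `|Re rootm| = k * sg.
Proof. by rewrite /= normrN gtr0_norm// mulr_gt0. Qed.

Lemma Re_rootp_neq0 : Re rootp != 0.
Proof. by rewrite -normr_gt0 Re_rootp mulr_gt0. Qed.

Lemma Re_rootm_neq0 : Re rootm != 0.
Proof. by rewrite -normr_gt0 Re_rootm mulr_gt0. Qed.

(** The maximum principle gives [2 K / (k sg)], and [sg >= 1/2]. *)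
Lemma solve_bound (r : C) f y K : `|Re r| = k * sg -> Per y ->
  wderiv y (fun x => r * y x + f x) -> (forall x, normc (f x) <= K) ->
  forall x, normc (y x) <= 4 * K / k.
Proof.
move=> rk Py dy fK x.
have r0 : Re r != 0 by rewrite -normr_gt0 rk mulr_gt0.
apply: le_trans (wderiv_bound M_gt0 w_gt0 r0 Py dy fK x) _.
have K0 : 0 <= K by apply: le_trans (fK 0); exact: normc_ge0.
rewrite rk ler_pdivrMr ?mulr_gt0//.
have -> : 4 * K / k * (k * sg) = 4 * K * sg by field; rewrite gt_eqF.
have /andP[h _] := halfsqrt3_itv; nra.
Qed.

Lemma Per_source y z : Per y -> Per z -> Per (source y z).
Proof.
move=> Py Pz; apply: PerD; first exact: PerM.
apply: PerM; last by apply: PerD => //; exact: Per_cst.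
by apply: PerD => //; apply: PerM => //; exact: Per_cst.
Qed.

(** Mean zero is an invariant of the iteration: it passes from [h] to [y] by averaging, it makes [z]
    periodic, and the mean [- m] left by the source cancels against [m (1 + z)], whose mean is
    [m]. *)
Lemma step_total h : Per h -> has_wmean h 0 ->
  exists2 h', Per h' /\ has_wmean h' 0 & step h h'.
Proof.
move=> Ph mh.
have [y Py dy] := wderiv_solve M_gt0 w_gt0 w_cont w_per dtheta theta0 Re_rootm_neq0 Ph.
have my : has_wmean y 0.
  apply: wderiv_mean_zero dy Py mh.
  by apply: contraNneq Re_rootm_neq0 => ->.
have [z [Pz dz mz]] := wderiv0_solve M_gt0 w_gt0 w_cont w_per dtheta theta0 Py my.
have PS := Per_source Py Pz.
have [m mS] := has_wmean_exists M_gt0 w_gt0 w_cont dtheta theta0 PS.1.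
have PF : Per (forcing h y z m).
  apply: PerD; last by apply: PerM; [exact: Per_cst | apply: PerD => //; exact: Per_cst].
  apply: PerD; last exact: PerN.
  by apply: PerD; apply: PerN; apply: PerM => //; exact: Per_cst.
have mF : has_wmean (forcing h y z m) 0.
  have h1 := has_wmeanB (has_wmeanB (has_wmeanZ (- beta%:C) mh) (has_wmeanZ kappa my)) mS.
  have h2 := has_wmeanZ m (has_wmeanD (has_wmean_cst M dtheta theta0 1) mz).
  apply: has_wmean_eq (has_wmeanD h1 h2) _ _ => [x|]; last by ring.
  by rewrite /forcing; ring.
have [h' Ph' dh'] := wderiv_solve M_gt0 w_gt0 w_cont w_per dtheta theta0 Re_rootp_neq0 PF.
exists h'; last by exists y, z, m.
split => //; apply: wderiv_mean_zero dh' Ph' mF.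
by apply: contraNneq Re_rootp_neq0 => ->.
Qed.

Local Notation K0 := (wbound0 M W theta).
Local Notation K1 := wbound1.

Let W_gt0 : 0 < W. Proof. exact: lt_le_trans (w_le 0). Qed.
Let P_gt0 : 0 < P. Proof. exact: (theta_period_gt0 M_gt0 w_gt0 dtheta theta0). Qed.
Let K1_ge0 : 0 <= K1.
Proof. by rewrite divr_ge0 ?(ltW P_gt0)// !mulr_ge0// ltW. Qed.
Let K0_ge0 : 0 <= K0.
Proof. by rewrite /wbound0 mulr_ge0 ?addr_ge0// !mulr_ge0// ltW. Qed.
Let B_ge0 : 0 <= B. Proof. exact: le_trans beta_le. Qed.

Lemma mean_bound f m K : has_wmean f m -> (forall x, normc (f x) <= K) -> normc m <= K1 * K.
Proof.
move=> mf fK; apply: le_trans (has_wmean_le M_gt0 w_gt0 w_le dtheta theta0 mf fK) _.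
by rewrite le_eqVlt; apply/orP; left; apply/eqP; rewrite /wbound1; field; rewrite gt_eqF.
Qed.

Lemma normc_kappa : normc kappa <= 5 * B * k.
Proof.
have rm : normc rootm <= 3 * k.
  apply: le_trans (normc_leRI _) _; rewrite Re_rootm /= ler0_norm; last first.
    by move: k_gt0; lra.
  have /andP[_ h] := halfsqrt3_itv; have : k * sg <= k * 1 by rewrite ler_wpM2l// ltW.
  by move: k_gt0; lra.
have nb : normc (beta%:C) <= B by rewrite normc_real.
have nk : normc (k%:C) <= k by rewrite normc_real gtr0_norm.
have n2 : normc (2 * 'i : C) <= 2.
  by apply: le_trans (normc_leRI _) _; rewrite !ReImE /= !(mulr0, mul0r, mulr1, addr0, subr0, oppr0, normr0, add0r) ger0_norm.
apply: le_trans (normc_leD (normc_leM nb rm) (normc_leM (normc_leM n2 nb) nk)) _.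
move: B_ge0 k_ge1; nra.
Qed.

Lemma step_yz_bound h h' y z m e : step_with h h' y z m -> (forall x, normc (h x) <= e) ->
  forall x, normc (y x) <= 4 * e / k /\ normc (z x) <= K0 * (4 * e / k).
Proof.
move=> [Py Pz dy dz [mz _ _ _]] he x.
have yb := solve_bound Re_rootm Py dy he; split => //.
exact: (wderiv0_bound M_gt0 w_gt0 w_le dtheta theta0 Pz dz mz yb).
Qed.

Lemma normc_coef x : normc ('i * k%:C * Cc x + Dc x) <= 2 * B * k.
Proof.
have nk : normc (k%:C) <= k by rewrite normc_real gtr0_norm.
have ni : normc ('i : C) <= 1 by rewrite /= expr0n /= expr1n add0r sqrtr1.
apply: le_trans (normc_leD (normc_leM (normc_leM ni nk) (C_le x)) (D_le x)) _.
move: B_ge0 k_ge1; nra.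
Qed.

Lemma source_bound y z x Y Z : normc (y x) <= Y -> normc (z x) <= Z ->
  normc (source y z x) <= B * Y + 2 * B * k * (1 + Z).
Proof.
move=> yY zZ; apply: normc_leD; first exact: normc_leM.
by apply: normc_leM; [exact: normc_coef | apply: normc_leD => //; rewrite normc1].
Qed.

(** By [solve_bound], [h'] is at most 4/k times the forcing bound [21 B K + 5 B k + 10 K1 B k]. The
    part proportional to [k] contributes [20 B + 40 K1 B], and [K] is twice that; the other half of
    [K] absorbs [84 B K / k] once [168 B <= k]. The other two conditions on [k] give [z <= 1/2] and
    [y <= 1] in norm. *)
Variable K : R.
Hypothesis K_def : K = 40 * B + 80 * K1 * B.
Hypotheses (kK0 : 8 * K0 * K <= k) (kK : 4 * K <= k) (kB : 168 * B <= k).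

Let K_ge0 : 0 <= K.
Proof. by have := mulr_ge0 K1_ge0 B_ge0; move: B_ge0; rewrite K_def; lra. Qed.

Let Yk : 0 <= 4 * K / k <= 1.
Proof.
apply/andP; split; last by rewrite ler_pdivrMr// mul1r.
by rewrite divr_ge0 ?mulr_ge0// ltW.
Qed.

Let Zk : K0 * (4 * K / k) <= 1 / 2.
Proof. by rewrite !mulrA ler_pdivrMr//; move: kK0; nra. Qed.

Lemma step_bounds h h' y z m : step_with h h' y z m -> (forall x, normc (h x) <= K) ->
  [/\ forall x, normc (y x) <= 4 * K / k, forall x, normc (z x) <= 1 / 2,
      forall x, normc (source y z x) <= 5 * B * k & normc m <= 5 * K1 * B * k].
Proof.
move=> S hK; have yz x := step_yz_bound S hK x; have [_ _ _ _ [_ mm _ _]] := S.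
have zb x : normc (z x) <= 1 / 2 by have [_ /le_trans] := yz x; apply.
have sb x : normc (source y z x) <= 5 * B * k.
  have [yb _] := yz x; apply: le_trans (source_bound yb (zb x)) _.
  have /andP[_ Y1] := Yk; have : B * (4 * K / k) <= B * 1 by exact: ler_wpM2l.
  have : B * 1 <= B * k by exact: ler_wpM2l.
  move: B_ge0; lra.
split=> // [x|]; first by have [] := yz x.
apply: le_trans (mean_bound mm sb) _.
by have -> : K1 * (5 * B * k) = 5 * K1 * B * k by ring.
Qed.

Lemma step_ball h h' : step h h' -> (forall x, normc (h x) <= K) ->
  forall x, normc (h' x) <= K.
Proof.
move=> [y [z [m S]]] hK; have [yb zb sb mb] := step_bounds S hK.
have [_ _ _ _ [_ _ Ph' dh']] := S.
have nb : normc (beta%:C) <= B by rewrite normc_real.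
have Fb x : normc (forcing h y z m x) <= 21 * B * K + 5 * B * k + 10 * K1 * B * k.
  have l1z : normc (1 + z x) <= 1 + 1 / 2 by apply: normc_leD => //; rewrite normc1.
  have := normc_leD (normc_leB (normc_leB (a := B * K) (u := - (beta%:C * h x))
    _ (normc_leM normc_kappa (yb x))) (sb x)) (normc_leM mb l1z).
  rewrite normc_opp => /(_ (normc_leM nb (hK x))) /le_trans; apply.
  have -> : 5 * B * k * (4 * K / k) = 20 * B * K by field; rewrite gt_eqF.
  have := mulr_ge0 (mulr_ge0 K1_ge0 B_ge0) (ltW k_gt0).
  move: (mulr_ge0 B_ge0 K_ge0) (mulr_ge0 B_ge0 (ltW k_gt0)); lra.
move=> x; apply: le_trans (solve_bound Re_rootp Ph' dh' Fb x) _.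
rewrite ler_pdivrMr//.
have l1 : 168 * B * K <= k * K by rewrite ler_wpM2r.
have -> : K * k = K / 2 * k + (20 * B + 40 * K1 * B) * k by rewrite {1 2}K_def; field.
have := mulr_ge0 (mulr_ge0 K1_ge0 B_ge0) (ltW k_gt0).
lra.
Qed.

(** The term [21 B] comes from [beta h] and [kappa y]. The bracket [4 B + 8 B K0] is the variation
    of the source: it enters once directly and, with factor [2 K1], through [(m1 - m2) (1 + z1)].
    The last term comes from [m2 (z1 - z2)]. Solving for [h'] multiplies by [4 / k], so
    [8 lipschitz_constant <= k] gives the ratio 1/2. *)
Definition lipschitz_constant :=
  21 * B + (1 + 2 * K1) * (4 * B + 8 * B * K0) + 20 * K1 * K0 * B.
Hypothesis kL : 8 * lipschitz_constant <= k.

Lemma step_lipschitz h1 h1' h2 h2' e :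
  (forall x, normc (h1 x) <= K) -> (forall x, normc (h2 x) <= K) ->
  step h1 h1' -> step h2 h2' ->
  (forall x, normc (h1 x - h2 x) <= e) -> forall x, normc (h1' x - h2' x) <= e / 2.
Proof.
move=> h1K h2K [y1 [z1 [m1 S1]]] [y2 [z2 [m2 S2]]] he.
have e0 : 0 <= e by apply: le_trans (he 0); exact: normc_ge0.
have [_ zb1 _ _] := step_bounds S1 h1K; have [_ _ _ mb2] := step_bounds S2 h2K.
have [Py1 Pz1 dy1 dz1 [mz1 mm1 Ph1 dh1]] := S1; have [Py2 Pz2 dy2 dz2 [mz2 mm2 Ph2 dh2]] := S2.
pose Y := 4 * e / k.
have Y0 : 0 <= Y by rewrite divr_ge0 ?mulr_ge0// ltW.
have Yk4 : Y * k = 4 * e by rewrite /Y; field; rewrite gt_eqF.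
have Y4 : Y <= 4 * e by move: k_ge1; nra.
have yb : forall x, normc (y1 x - y2 x) <= Y.
  apply: (solve_bound Re_rootm (PerD Py1 (PerN Py2)) _ he).
  by apply: wderiv_eq (wderivB dy1 dy2) _ => x; ring.
have zb : forall x, normc (z1 x - z2 x) <= K0 * Y.
  apply: (wderiv0_bound M_gt0 w_gt0 w_le dtheta theta0 (PerD Pz1 (PerN Pz2)) (wderivB dz1 dz2) _ yb).
  by apply: has_wmean_eq (has_wmeanB mz1 mz2) _ _ => //; rewrite subrr.
have sb x : normc (source y1 z1 x - source y2 z2 x) <= (4 * B + 8 * B * K0) * e.
  have -> : source y1 z1 x - source y2 z2 x =
     Cc x * (y1 x - y2 x) + ('i * k%:C * Cc x + Dc x) * (z1 x - z2 x).
    by rewrite /source; ring.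
  apply: le_trans (normc_leD (normc_leM (C_le x) (yb x)) (normc_leM (normc_coef x) (zb x))) _.
  have -> : 2 * B * k * (K0 * Y) = 2 * B * K0 * (Y * k) by ring.
  rewrite Yk4; have : B * Y <= B * (4 * e) by exact: ler_wpM2l.
  lra.
have mb := mean_bound (has_wmeanB mm1 mm2) sb.
have nb : normc (beta%:C) <= B by rewrite normc_real.
have Fb x : normc (forcing h1 y1 z1 m1 x - forcing h2 y2 z2 m2 x) <= lipschitz_constant * e.
  have -> : forcing h1 y1 z1 m1 x - forcing h2 y2 z2 m2 x =
     - (beta%:C * (h1 x - h2 x)) - kappa * (y1 x - y2 x)
     - (source y1 z1 x - source y2 z2 x) + (m1 - m2) * (1 + z1 x) + m2 * (z1 x - z2 x).
    by rewrite /forcing; ring.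
  have l1z : normc (1 + z1 x) <= 2.
    by apply: le_trans (normc_leD (lexx _) (zb1 x)) _; rewrite normc1; lra.
  have := normc_leD (normc_leD (normc_leB (normc_leB (a := B * e) (u := - (beta%:C * (h1 x - h2 x)))
    _ (normc_leM normc_kappa (yb x))) (sb x)) (normc_leM mb l1z)) (normc_leM mb2 (zb x)).
  rewrite normc_opp => /(_ (normc_leM nb (he x))) /le_trans; apply.
  have -> : 5 * B * k * Y = 5 * B * (Y * k) by ring.
  have -> : 5 * K1 * B * k * (K0 * Y) = 5 * K1 * B * K0 * (Y * k) by ring.
  rewrite Yk4 le_eqVlt; apply/orP; left; apply/eqP; rewrite /lipschitz_constant; ring.
move=> x.
have dd : wderiv (fun x => h1' x - h2' x) (fun x => rootp * (h1' x - h2' x) +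
    (forcing h1 y1 z1 m1 x - forcing h2 y2 z2 m2 x)).
  by apply: wderiv_eq (wderivB dh1 dh2) _ => t; ring.
apply: le_trans (solve_bound Re_rootp (PerD Ph1 (PerN Ph2)) dd Fb x) _.
rewrite ler_pdivrMr//.
have : 8 * lipschitz_constant * e <= k * e by rewrite ler_wpM2r.
lra.
Qed.

Lemma step_fixed_point : exists h y z m,
  [/\ Per h, step_with h h y z m, forall x, normc (z x) <= 1 / 2 & normc m <= 5 * K1 * B * k].
Proof.
have [||||h [[Ph mh] hK] [y [z [m S]]]] :=
  @relational_fixed_point R (fun h => Per h /\ has_wmean h 0) step K (fun=> 0).
- split; first by split; [exact: Per_cst | exact: has_wmean_cst].
  by move=> x; rewrite normc0.
- move=> h [[Ph mh] hK]; have [h' [Ph' mh'] S] := step_total Ph mh.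
  by exists h' => //; split => // x; exact: step_ball S hK x.
- by move=> h1 h1' h2 h2' e [_ h1K] [_ h2K] S1 S2 he x; exact: (step_lipschitz h1K h2K S1 S2 he x).
- by move=> u h A Xu uh; exact: mean_zero_closed Xu uh.
exists h, y, z, m; have [_ zb _ mb] := step_bounds S hK.
by split.
Qed.

End Frequency.

Lemma large_frequency_solution : exists k0 K', forall k, k0 <= k -> 1 <= k /\
  exists h y z m, [/\ Per h, step_with k h h y z m, forall x, normc (z x) <= 1 / 2 & normc m <= K' * k].
Proof.
pose K1 := wbound1; pose K0 := wbound0 M W theta; pose K := 40 * B + 80 * K1 * B.
exists (Num.max 1 (Num.max (8 * K0 * K) (Num.max (4 * K) (Num.max (168 * B) (8 * lipschitz_constant))))).
exists (5 * K1 * B) => k; rewrite !ge_max => /and5P[k1 kK0 kK kB kL]; split => //.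
exact: (step_fixed_point k1 (K := K)).
Qed.

End Perturbation.

(** * The eigenfunctions *)

Lemma deriv_of_periodic (R : realType) (M : R) (F f : R -> R) : deriv_of F f -> Mperiodic M f ->
  forall x, F (x + M) = F x + (F M - F 0).
Proof.
move=> dF fM x.
have sM : deriv_of (fun x : R => x + M) (fun=> 1 + 0).
  by apply: deriv_ofD; [move=> y; exact: is_derive_id | exact: deriv_of_cst].
have d1 : deriv_of (fun x => F (x + M)) f.
  by apply: deriv_of_eq (deriv_of_comp dF sM) _ => y; rewrite addr0 mulr1 fM.
have d2 : deriv_of (fun x => F x + (F M - F 0)) f.
  by apply: deriv_of_eq (deriv_ofD dF (deriv_of_cst _)) _ => y; rewrite addr0.
by apply: (deriv_of_unique d1 d2 _ x); rewrite add0r addrC subrK.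
Qed.

Lemma Mperiodic_bounded (R : realType) (M : R) (f : R -> R) : 0 < M -> continuous f -> Mperiodic M f ->
  exists B, forall x, `|f x| <= B.
Proof.
move=> M0 cf fM; have cn : continuous (fun x => `|f x|) by move=> x; apply: cvg_norm; exact: cf.
have [|x0 h] := Mperiodic_max M0 cn; first by move=> x; rewrite fM.
by exists `|f x0|.
Qed.

(** * From classical solutions to eigenvalues on the Sobolev domain *)

Section ClassicalH3.
Variables (R : realType) (M : R).
Hypothesis M_gt0 : 0 < M.
Implicit Types f g u : R -> R.
Notation mu := (@lebesgue_measure R).

Lemma continuous_L2on f : continuous f -> L2on M f.
Proof.
move=> cf; split.
  by apply: measurable_funTS; exact: measurable_realfun.continuous_measurable_fun.
have c2 : continuous (fun x => f x ^+ 2) by move=> x; apply: cvgM; exact: cf.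
have [F dF _] := primitive_exists c2.
by rewrite (integral_primitive M_gt0 c2 dF) ltry.
Qed.

(** Integration by parts, read off primitives of both integrands; the boundary terms cancel because
    [f] and the test function are periodic. *)
Lemma deriv_of_weak_deriv f f' : deriv_of f f' -> continuous f' -> Mperiodic M f -> weak_deriv M f f'.
Proof.
move=> df cf' fM phi sphi phiM.
have dphi : deriv_of phi (derive1 phi).
  by move=> x; apply: DeriveDef; [exact: (sphi 0%N x) | rewrite derive1E].
have cphi' : continuous (derive1 phi).
  by move=> x; apply/differentiable_continuous/derivable1_diffP; exact: (sphi 1%N x).
have cf := deriv_of_continuous df; have cphi := deriv_of_continuous dphi.
have c1 : continuous (fun x => f x * derive1 phi x) by move=> x; apply: cvgM; [exact: cf|exact: cphi'].
have c2 : continuous (fun x => f' x * phi x) by move=> x; apply: cvgM; [exact: cf'|exact: cphi].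
have [F1 d1 e1] := primitive_exists c1; have [F2 d2 e2] := primitive_exists c2.
rewrite (integral_primitive M_gt0 c1 d1) (integral_primitive M_gt0 c2 d2) -EFinN; congr EFin.
have d0 : deriv_of (fun x => F2 x + F1 x - f x * phi x) (fun=> 0).
  by apply: deriv_of_eq (deriv_ofB (deriv_ofD d2 d1) (deriv_ofM df dphi)) _ => x; rewrite subrr.
have := deriv_of0 M 0 d0; rewrite -[in f M](add0r M) -[in phi M](add0r M) fM phiM e1 e2.
lra.
Qed.

Lemma classical_H3 u u1 u2 u3 : Mperiodic M u -> deriv_of u u1 -> deriv_of u1 u2 ->
  deriv_of u2 u3 -> continuous u3 -> H3_with M u u1 u2 u3.
Proof.
move=> uM d1 d2 d3 c3.
have u1M := deriv_ofS d1 uM; have u2M := deriv_ofS d2 u1M; have u3M := deriv_ofS d3 u2M.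
have c0 := deriv_of_continuous d1; have c1 := deriv_of_continuous d2.
have c2 := deriv_of_continuous d3.
split; split => //; try exact: continuous_L2on.
- exact: deriv_of_weak_deriv d1 c1 uM.
- exact: deriv_of_weak_deriv d2 c2 u1M.
- exact: deriv_of_weak_deriv d3 c3 u2M.
Qed.

Lemma not_ae_zero (ur ui : R -> R) : (forall x, ~ (ur x = 0 /\ ui x = 0)) ->
  ~ {ae mu, forall x, x \in `[0%R, M] -> ur x = 0 /\ ui x = 0}.
Proof.
move=> nz [N [mN N0 sub]].
have : (mu `[0%R, M] <= mu N)%E.
  apply: le_measure; rewrite ?inE//.
  by move=> x xM; apply: sub => /= h; apply: (nz x); apply: h; rewrite ?inE.
by rewrite N0 lebesgue_measure_itv /= lte_fin M_gt0 -EFinB subr0 lee_fin leNgt M_gt0.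
Qed.

Lemma classical_eigenvalue (a b c d : R -> R) (lam : R[i]) (u u1 u2 u3 : R -> R[i]) :
  (forall x, u (x + M) = u x) -> (forall x, u x != 0) ->
  cderiv u u1 -> cderiv u1 u2 -> cderiv u2 u3 -> ccont u3 ->
  (forall x, (a x)%:C * u3 x + (b x)%:C * u2 x + (c x)%:C * u1 x + (d x)%:C * u x = lam * u x) ->
  is_eigenvalue M a b c d (Re lam, Im lam).
Proof.
move=> uM nz [r1 i1] [r2 i2] [r3 i3] [cr ci] e.
exists (fun x => Re (u x)), (fun x => Re (u1 x)), (fun x => Re (u2 x)), (fun x => Re (u3 x)).
exists (fun x => Im (u x)), (fun x => Im (u1 x)), (fun x => Im (u2 x)), (fun x => Im (u3 x)).
split.
- by apply: classical_H3 => // x; rewrite uM.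
- by apply: classical_H3 => // x; rewrite uM.
- apply: not_ae_zero => x [h1 h2]; have /eqP := nz x; apply; exact: complex_eq.
- apply: aeW => x _; split.
    by have := congr1 (@complex.Re R) (e x); rewrite !ReImE /= !mul0r !subr0.
  have := congr1 (@complex.Im R) (e x); rewrite !ReImE /= !mul0r !addr0 => ->.
  by rewrite addrC.
Qed.

End ClassicalH3.

(* [s], [A1], [A2], [A3] are the logarithmic factors of [H], [d u], [d^2 u], [d^3 u] for
   [u = H v], [d H = s H], [d v = y], [d y = rm y + h] and [d h = rp h + F]. *)
Lemma conjugated_equation (A : comRingType) (I k beta g g1 g2 ct d m rp rm v y h F C D : A) :
  I * I = -1 -> rp + rm = - 3 * (I * k) -> rp * rm = - 3 * (k * k) ->
  C = 3 * g ^+ 2 + 3 * g1 + 2 * (beta - 3 * g) * g + ct ->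
  D = g ^+ 3 + 3 * g * g1 + g2 + (beta - 3 * g) * (g ^+ 2 + g1) + ct * g + d ->
  F = - (beta * h) - (beta * rm + 2 * I * beta * k) * y
      - (C * y + (I * k * C + D) * v) + m * v ->
  let s := g + I * k in
  let y1 := rm * y + h in
  let A1 := s * v + y in
  let dA1 := g1 * v + s * y + y1 in
  let A2 := s * A1 + dA1 in
  let dA2 := g1 * A1 + s * dA1 + (g2 * v + g1 * y + (g1 * y + s * y1) + (rm * y1 + (rp * h + F))) in
  let A3 := s * A2 + dA2 in
  A3 + (beta - 3 * g) * A2 + ct * A1 + d * v = (- (I * k ^+ 3) - beta * k ^+ 2 + m) * v.
Proof.
move=> II eD eM eC eDD eF /=.
have E1 : I * I + 1 = 0 by rewrite II addNr.
have E2 : rp + rm + 3 * (I * k) = 0 by rewrite eD; ring.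
have E3 : rp * rm + 3 * (k * k) = 0 by rewrite eM; ring.
apply/eqP; rewrite -subr_eq0; apply/eqP.
(* A certificate of ideal membership: the residual is an explicit combination of the relations [E1],
   [E2], [E3] on [I], [rp], [rm], and the rest is a polynomial identity. *)
transitivity ((rm * y + h) * (rp + rm + 3 * (I * k)) - y * (rp * rm + 3 * (k * k))
  + (I * I + 1) * (3 * k ^+ 2 * y + (I * k ^+ 3 + beta * k ^+ 2) * v)).
  by rewrite eF eDD eC; ring.
by rewrite E1 E2 E3; ring.
Qed.

(** * Passing between ordinary derivatives and the derivation [q D] *)

Section ChangeOfVariable.
Variable R : realType.
Local Notation C := R[i].
Variables (q q1 q2 : R -> R).
Hypotheses (q_gt0 : forall x, 0 < q x) (dq : deriv_of q q1) (dq1 : deriv_of q1 q2).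
Local Notation w := (fun x => (q x)^-1).

Lemma wderiv_real (f f' : R -> R) : deriv_of f f' ->
  wderiv w (fun x => (f x)%:C) (fun x => (q x * f' x)%:C).
Proof.
move=> df; apply: cderiv_eq (cderiv_real df) _ => x.
by rewrite -rmorphM /= mulKf// gt_eqF.
Qed.

(* The derivatives of [u] in terms of its iterates [p1, p2, p3] under [d = q D]. *)
Lemma deriv_from_wderiv (u p1 p2 p3 : R -> C) :
  wderiv w u p1 -> wderiv w p1 p2 -> wderiv w p2 p3 ->
  let W x := (q x)^-1%:C in let Q1 x := (q1 x)%:C in
  let u1 x := W x * p1 x in
  let u2 x := W x ^+ 2 * (p2 x - Q1 x * p1 x) in
  let u3 x := W x ^+ 3 * (p3 x - 3 * Q1 x * p2 x + (2 * Q1 x ^+ 2 - (q x * q2 x)%:C) * p1 x) in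
  [/\ cderiv u u1, cderiv u1 u2 & cderiv u2 u3].
Proof.
move=> d1 d2 d3 W Q1 u1 u2 u3.
have q0 x : q x != 0 by rewrite gt_eqF.
have dW : wderiv w W (fun x => - Q1 x * W x).
  apply: wderiv_eq (wderiv_real (deriv_of_inv q0 dq)) _ => x.
  rewrite /W /Q1 -rmorphN -rmorphM /=; congr (_%:C); field; exact: q0.
have dQ : wderiv w Q1 (fun x => (q x * q2 x)%:C) := wderiv_real dq1.
split=> //.
- apply: cderiv_eq (wderivM dW d2) _ => x; rewrite /u2 -/(W x); ring.
- have dW2 := wderivM dW dW.
  apply: (cderiv_eq (f := u2)); last first.
    move=> x; rewrite /u3.
    instantiate (1 := fun x => W x * ((- Q1 x * W x * W x + W x * (- Q1 x * W x)) * (p2 x - Q1 x * p1 x)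
      + W x * W x * (p3 x - ((q x * q2 x)%:C * p1 x + Q1 x * p2 x)))).
    by rewrite /=; ring.
  by have := wderivM dW2 (wderivB d3 (wderivM dQ d2)); rewrite /u2 /W.
Qed.

End ChangeOfVariable.

(** The function [q = exp (ln a / 3)] solves the linear equation [q' = a' / (3 a) * q], so the
    smoothness of [a] is inherited by bootstrap. *)
Lemma cube_root_exists (R : realType) (a : R -> R) : (forall x, 0 < a x) -> (forall n, Ck n a) ->
  exists q : R -> R, [/\ forall x, 0 < q x, forall x, q x ^+ 3 = a x, forall n, Ck n q &
                forall M, Mperiodic M a -> Mperiodic M q].
Proof.
move=> a0 Ca; exists (fun x => expR (3^-1 * ln (a x))); split.
- by move=> x; exact: expR_gt0.
- by move=> x; rewrite -expRM_natl mulrA divff// mul1r lnK ?posrE.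
- have [a1 da _] := Ca 1%N.
  have dl : deriv_of (fun x => ln (a x)) (fun x => (a x)^-1 * a1 x).
    by move=> x; have := da x; have := is_derive1_ln (a0 x) => ? ?; exact: is_derive1_comp.
  have dq := deriv_of_comp (@is_derive_expR R) (deriv_ofM (deriv_of_cst 3^-1) dl).
  have Cg n : Ck n (fun x => 3^-1 * ((a x)^-1 * a1 x)).
    apply: CkM; first exact: Ck_cst.
    apply: CkM; first by apply: Ck_inv => // x; rewrite gt_eqF.
    have [a1' da' Ca1'] := Ca n.+1.
    (* Each order of smoothness comes with its own witness for the derivative; uniqueness identifies
       them all with [a1]. *)
    suff -> : a1 = a1' by [].
    by apply/funext => x; have [_ <-] := da x; have [_ <-] := da' x.
  have dq' : deriv_of (fun x => expR (3^-1 * ln (a x)))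
     (fun x => 3^-1 * ((a x)^-1 * a1 x) * expR (3^-1 * ln (a x))).
    by apply: deriv_of_eq dq _ => x; rewrite mul0r add0r mulrC.
  move=> n; apply: CkS; exact: Ck_linear_ode dq' (Cg n).
- by move=> M aM x; rewrite aM.
Qed.

Lemma ccontX (R : realType) (f : R -> R[i]) n : ccont f -> ccont (fun x => f x ^+ n).
Proof.
move=> cf; elim: n => [|n IH]; first exact: ccont_cst.
by under eq_fun do rewrite exprS; exact: ccontM.
Qed.

Lemma CkX (R : realType) n (f : R -> R) m : Ck n f -> Ck n (fun x => f x ^+ m).
Proof.
move=> cf; elim: m => [|m IH]; first exact: Ck_cst.
by under eq_fun do rewrite exprS; exact: CkM.
Qed.

Ltac Ck_auto := lazymatch goal with
  | |- Ck _ (fun _ => ?e) => exact: Ck_cst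
  | |- Ck ?n (fun x => @?f x + @?g x) => apply: (@CkD _ n f g); Ck_auto
  | |- Ck ?n (fun x => @?f x * @?g x) => apply: (@CkM _ n f g); Ck_auto
  | |- Ck ?n (fun x => - @?f x) => apply: (@CkN _ n f); Ck_auto
  | |- Ck ?n (fun x => @?f x ^+ ?m) => apply: (@CkX _ n f m); Ck_auto
  | |- _ => assumption
  end.
Ltac ccont_auto := lazymatch goal with
  | |- ccont (fun _ => ?e) => exact: ccont_cst
  | |- ccont (fun x => @?f x + @?g x) => apply: (@ccontD _ f g); ccont_auto
  | |- ccont (fun x => @?f x * @?g x) => apply: (@ccontM _ f g); ccont_auto
  | |- ccont (fun x => - @?f x) => apply: (@ccontN _ f); ccont_auto
  | |- ccont (fun x => @?f x ^+ ?m) => apply: (@ccontX _ f m); ccont_auto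
  | |- _ => assumption
  end.

(** * The eigenfunction built from a fixed point *)

Section Eigenfunction.
Variable R : realType.
Local Notation C := R[i].
Variables (M : R) (a b c d q q1 q2 g gd gdd theta G : R -> R) (beta k : R).
Local Notation w := (fun x => (q x)^-1).
Hypotheses (M_gt0 : 0 < M) (q_gt0 : forall x, 0 < q x).
Hypotheses (dq : deriv_of q q1) (dq1 : deriv_of q1 q2).
Hypotheses (dg : deriv_of g gd) (dgd : deriv_of gd gdd) (dtheta : deriv_of theta w).
Hypotheses (dG : deriv_of G (fun x => (q x)^-1 * (g x * G x))).
Hypotheses (cq2 : continuous q2) (cgdd : continuous gdd) (cc : continuous c) (cd : continuous d).
Hypotheses (a_def : forall x, a x = q x ^+ 3).
Hypotheses (b_def : forall x, b x = q x ^+ 2 * (beta - 3 * g x + 3 * q1 x)).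

Definition dg1 x := q x * gd x.
Definition dg2 x := q x * (q1 x * gd x + q x * gdd x).
(** The coefficient of [d] when the operator is rewritten in powers of [d = q D]: it becomes
    [d^3 + (beta - 3 g) d^2 + ctilde d] plus the zeroth-order term. *)
Definition ctilde x :=
  - q1 x ^+ 2 - q x * q2 x - beta * q1 x + 3 * g x * q1 x + c x / q x.
(** Conjugation by [G] replaces [d] by [d + g]. The coefficient of [d^2] becomes the constant
    [beta]; [Ccoef] and [Dcoef] are the resulting coefficients of first and zeroth order. *)
Definition Ccoef x :=
  3 * g x ^+ 2 + 3 * dg1 x + 2 * (beta - 3 * g x) * g x + ctilde x.
Definition Dcoef x :=
  g x ^+ 3 + 3 * g x * dg1 x + dg2 x + (beta - 3 * g x) * (g x ^+ 2 + dg1 x)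
  + ctilde x * g x + d x.

Local Notation Cc := (fun x => (Ccoef x)%:C).
Local Notation Dc := (fun x => (Dcoef x)%:C).

Lemma continuous_dg2 : continuous dg2.
Proof.
have C0 : Ck 0 q := deriv_of_continuous dq; have C1 : Ck 0 q1 := deriv_of_continuous dq1.
have C2 : Ck 0 gd := deriv_of_continuous dgd; have C3 : Ck 0 gdd := cgdd.
by change (Ck 0 dg2); rewrite /dg2; Ck_auto.
Qed.

Lemma continuous_coefs : continuous Ccoef /\ continuous Dcoef.
Proof.
have q0 x : q x != 0 by rewrite gt_eqF.
have C0 : Ck 0 q := deriv_of_continuous dq; have C1 : Ck 0 q1 := deriv_of_continuous dq1.
have C2 : Ck 0 gd := deriv_of_continuous dgd; have C3 : Ck 0 gdd := cgdd.
have C4 : Ck 0 w := deriv_of_continuous (deriv_of_inv q0 dq).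
have C5 : Ck 0 g := deriv_of_continuous dg; have C6 : Ck 0 q2 := cq2.
have C7 : Ck 0 c := cc; have C8 : Ck 0 d := cd.
split; [change (Ck 0 Ccoef) | change (Ck 0 Dcoef)];
  rewrite /Dcoef /Ccoef /dg1 /dg2 /ctilde; Ck_auto.
Qed.

Lemma eigenfunction h y z m :
  Per M h -> step_with M w theta Cc Dc beta k h h y z m ->
  (forall x, normc (z x) <= 1 / 2) ->
  Mperiodic M G -> (forall x, 0 < G x) ->
  (forall x, cexp ('i * k%:C * (theta (x + M))%:C) = cexp ('i * k%:C * (theta x)%:C)) ->
  let lam := - ('i * k%:C ^+ 3) - beta%:C * k%:C ^+ 2 + m in
  is_eigenvalue M a b c d (Re lam, Im lam).
Proof.
move=> Ph [Py Pz dy dz [_ _ _ dh]] zb GM G_gt0 EM lam.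
have q0 x : q x != 0 by rewrite gt_eqF.
have qC0 x : (q x)%:C != 0 :> C by rewrite eq_complex /= negb_and q0.
pose H x : C := (G x)%:C * cexp ('i * k%:C * (theta x)%:C).
pose s x : C := (g x)%:C + 'i * k%:C.
have dGc : wderiv w (fun x => (G x)%:C) (fun x => (g x)%:C * (G x)%:C).
  apply: wderiv_eq (wderiv_real q_gt0 dG) _ => x.
  by rewrite mulrA mulfV// mul1r rmorphM.
have dH : wderiv w H (fun x => s x * H x).
  apply: wderiv_eq (wderivM dGc (wderiv_cexp dtheta ('i * k%:C))) _ => x.
  by rewrite /s /H; ring.
have ds : wderiv w s (fun x => (dg1 x)%:C).
  apply: wderiv_eq (wderivD (wderiv_real q_gt0 dg) (wderiv_cst w ('i * k%:C))) _ => x.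
  by rewrite addr0.
have ddg : wderiv w (fun x => (dg1 x)%:C) (fun x => (dg2 x)%:C).
  exact: (wderiv_real q_gt0 (deriv_ofM dq dgd)).
pose v x : C := 1 + z x.
have dv : wderiv w v y.
  by apply: wderiv_eq (wderivD (wderiv_cst w 1) dz) _ => x; rewrite add0r.
pose F x := forcing Cc Dc beta k h y z m x.
pose y1 x : C := rootm k * y x + h x.
pose y2 x : C := rootm k * y1 x + (rootp k * h x + F x).
have dy1 : wderiv w y1 y2 by apply: wderivD dh; exact: wderivZ.
pose A1 x : C := s x * v x + y x.
pose dA1 x : C := (dg1 x)%:C * v x + s x * y x + y1 x.
have dA1P : wderiv w A1 dA1 by apply: wderivD dy; exact: wderivM.
pose A2 x : C := s x * A1 x + dA1 x.
pose dA2 x : C := (dg1 x)%:C * A1 x + s x * dA1 x +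
  ((dg2 x)%:C * v x + (dg1 x)%:C * y x + ((dg1 x)%:C * y x + s x * y1 x) + y2 x).
have dA2P : wderiv w A2 dA2.
  apply: wderivD; first exact: wderivM.
  by apply: wderivD dy1; apply: wderivD; exact: wderivM.
pose A3 x : C := s x * A2 x + dA2 x.
have d1 : wderiv w (fun x => H x * v x) (fun x => H x * A1 x).
  by apply: wderiv_eq (wderivM dH dv) _ => x; rewrite /A1; ring.
have d2 : wderiv w (fun x => H x * A1 x) (fun x => H x * A2 x).
  by apply: wderiv_eq (wderivM dH dA1P) _ => x; rewrite /A2; ring.
have d3 : wderiv w (fun x => H x * A2 x) (fun x => H x * A3 x).
  by apply: wderiv_eq (wderivM dH dA2P) _ => x; rewrite /A3; ring.
have /= [e1 e2 e3] := deriv_from_wderiv q_gt0 dq dq1 d1 d2 d3.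
apply: (classical_eigenvalue M_gt0 _ _ e1 e2 e3).
- by move=> x; rewrite /H /v GM EM; congr (_ * (_ + _)); have [_ ->] := Pz.
(* The bound 1/2 on [z] keeps [1 + z] away from 0, so the eigenfunction vanishes nowhere. *)
- move=> x; rewrite /H !mulf_neq0 ?cexp_neq0//.
    by rewrite eq_complex /= negb_and gt_eqF.
  apply/eqP => /(congr1 (fun t => normc (t - z x))); rewrite /v addrK normc1 sub0r normc_opp => e.
  by have := zb x; rewrite -e; lra.
- have cQ := ccont_real (deriv_of_continuous dq); have cQ1 := ccont_real (deriv_of_continuous dq1).
  have cW := ccont_real (deriv_of_continuous (deriv_of_inv q0 dq)).
  have cH := cderiv_ccont dH; have cs := cderiv_ccont ds; have cv := cderiv_ccont dv.
  have cA1 := cderiv_ccont dA1P; have cA2 := cderiv_ccont dA2P.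
  have cdg1 := cderiv_ccont ddg; have cy := cderiv_ccont dy; have cy1 := cderiv_ccont dy1.
  have cz := cderiv_ccont dz.
  have ch := Ph.1.
  have [kC kD] := continuous_coefs.
  have cCc := ccont_real kC; have cDc := ccont_real kD; have cq2c := ccont_real cq2.
  have cdg2 : ccont (fun x => (dg2 x)%:C) by exact/ccont_real/continuous_dg2.
  have cqq2 : ccont (fun x => (q x * q2 x)%:C).
    exact/ccont_real/(CkM (n := 0) (deriv_of_continuous dq) cq2).
  have cF : ccont F by rewrite /F /forcing /source; ccont_auto.
  have cy2 : ccont y2 by rewrite /y2; ccont_auto.
  have cdA1 : ccont dA1 by rewrite /dA1; ccont_auto.
  have cdA2 : ccont dA2 by rewrite /dA2; ccont_auto.
  have cA3 : ccont A3 by rewrite /A3; ccont_auto.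
  by ccont_auto.
- move=> x.
  have aE : (a x)%:C = (q x)%:C ^+ 3 :> C by rewrite a_def rmorphXn.
  have bE : (b x)%:C = (q x)%:C ^+ 2 * (beta%:C - 3 * (g x)%:C + 3 * (q1 x)%:C) :> C.
    by rewrite b_def; ring.
  have ctE : (ctilde x)%:C = - (q1 x)%:C ^+ 2 - (q x)%:C * (q2 x)%:C - beta%:C * (q1 x)%:C
      + 3 * (g x)%:C * (q1 x)%:C + (c x)%:C / (q x)%:C :> C.
    rewrite /ctilde; field; exact: qC0.
  have := @conjugated_equation C 'i k%:C beta%:C (g x)%:C (dg1 x)%:C (dg2 x)%:C (ctilde x)%:C
    (d x)%:C m (rootp k) (rootm k) (v x) (y x) (h x) (F x) (Ccoef x)%:C (Dcoef x)%:C.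
  move=> /(_ _ (rootsD k) (rootsM k) _ _ _) /=.
  rewrite -/(s x) -/(y1 x) -/(A1 x) -/(dA1 x) -/(A2 x) -/(y2 x) -/(dA2 x) -/(A3 x) -/lam => key.
  have {}key : A3 x + (beta%:C - 3 * (g x)%:C) * A2 x + (ctilde x)%:C * A1 x + (d x)%:C * v x = lam * v x.
    apply: key.
    + by apply: complex_eq; rewrite !ReImE /=; ring.
    + by rewrite /Ccoef; ring.
    + by rewrite /Dcoef; ring.
    + by rewrite /F /forcing /source /kappa /v; ring.
  (* Pulling [H x] out of the right-hand side lets [key] apply; what remains is the change from [D]
     to [d], a rational identity in [q x]. *)
  rewrite [RHS]mulrCA -key aE bE ctE fmorphV rmorphM /=; field; exact: qC0.
Qed.
End Eigenfunction.

(** * The gauge, the admissible frequencies and the asymptotics *)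

Lemma deltabarE (R : realType) (M : R) (a b F : R -> R) : 0 < M -> (forall x, 0 < a x) ->
  continuous a -> continuous b -> deriv_of F (fun x => b x / a x) ->
  deltabar M a b = M^-1 * (F M - F 0).
Proof.
move=> M0 a0 ca cb dF; rewrite /deltabar; congr (_ * _).
have cba : continuous (fun x => b x / a x).
  by move=> x; apply: cvgM; [exact: cb | apply: cvgV; [rewrite gt_eqF | exact: ca]].
by rewrite /Rintegral (integral_primitive M0 cba dF).
Qed.

Lemma eigenvalue_asymptotics (R : realType) (M : R) (a b c d : R -> R) :
  0 < M -> (forall x, 0 < a x) ->
  (forall n, Ck n a) -> Ck 2 b -> continuous c -> continuous d ->
  Mperiodic M a -> Mperiodic M b -> Mperiodic M c -> Mperiodic M d ->
  exists P beta k0 K : R, [/\ 0 < P, beta * P = M * deltabar M a b &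
    forall n : nat, let k := 2 * pi / P * n%:R in k0 <= k ->
      exists lam, is_eigenvalue M a b c d lam /\ `|lam.1 + beta * k ^+ 2| <= K * k].
Proof.
move=> M0 a0 Ca Cb cc cd aM bM cM dM.
have [q [q_gt0 q3 Cq qM]] := cube_root_exists a0 Ca; have {}qM := qM M aM.
have q0 x : q x != 0 by rewrite gt_eqF.
have [q1 dq Cq1] := Cq 3%N; have [q2 dq1 Cq2] := Cq1.
have cq2 : continuous q2 := Ck_continuous (n := 1) Cq2.
have q1M := deriv_ofS dq qM; have q2M := deriv_ofS dq1 q1M.
pose w x := (q x)^-1.
have w_gt0 x : 0 < w x by rewrite invr_gt0.
have Cw n : Ck n w by apply: Ck_inv.
have w_cont := Ck_continuous (Cw 0%N).
have wM : Mperiodic M w by move=> x; rewrite /w qM.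
have [W w_norm] := Mperiodic_bounded M0 w_cont wM.
have w_le x : w x <= W by apply: le_trans (w_norm x); exact: ler_norm.
have [theta dtheta theta0] := primitive_exists w_cont.
have P_gt0 := theta_period_gt0 M0 w_gt0 dtheta theta0.
pose P := theta M; rewrite -/P in P_gt0.
have cba : continuous (fun x => b x / a x).
  by apply: (@CkM _ 0); [exact: Ck_continuous Cb | apply: Ck_inv => // x; rewrite gt_eqF].
have [S dS S0] := primitive_exists cba.
(* This is the only constant for which [beta * theta - S] is periodic, hence for which the gauge
   below is. *)
pose beta := S M / P.
have bP : beta * P = S M by rewrite /beta divfK// gt_eqF.
(* The relation [b_def] solved for [g]. *)
pose g x := 3^-1 * beta - 3^-1 * (b x * (w x * w x)) + q1 x.
have Cg : Ck 2 g.
  apply: CkD => //; apply: CkD; first exact: Ck_cst.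
  by apply: CkN; apply: CkM; [exact: Ck_cst | apply: CkM => //; apply: CkM].
have [gd dg [gdd dgd cgdd]] := Cg.
have gM : Mperiodic M g by move=> x; rewrite /g bM wM q1M.
have gdM := deriv_ofS dg gM; have gddM := deriv_ofS dgd gdM.
(* The gauge must satisfy [d G = g G]. The factor [q] of [G] accounts for [q1] in [g], and [d phi]
   is the rest, [(beta - b / q^2) / 3]. *)
pose phi x := 3^-1 * (beta * theta x - S x).
have dphi : deriv_of phi (fun x => 3^-1 * (beta * w x - b x / a x)).
  apply: deriv_of_eq (deriv_ofM (deriv_of_cst 3^-1)
    (deriv_ofB (deriv_ofM (deriv_of_cst beta) dtheta) dS)) _ => x.
  by rewrite !mul0r !add0r.
have phiM : Mperiodic M phi.
  move=> x; rewrite (deriv_of_periodic dphi); last by move=> y; rewrite wM aM bM.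
  by rewrite {2 3}/phi -/P bP theta0 S0; ring.
pose G x := q x * expR (phi x).
have dG : deriv_of G (fun x => (q x)^-1 * (g x * G x)).
  apply: deriv_of_eq (deriv_ofM dq (deriv_of_comp (@is_derive_expR R) dphi)) _ => x.
  rewrite /G /g /w -q3; field; exact: q0.
have G_gt0 x : 0 < G x by rewrite mulr_gt0// expR_gt0.
have GM : Mperiodic M G by move=> x; rewrite /G qM phiM.
have b_def x : b x = q x ^+ 2 * (beta - 3 * g x + 3 * q1 x).
  by rewrite /g /w; field; exact: q0.
have a_def x : a x = q x ^+ 3 by rewrite q3.
have [cC cD] := continuous_coefs beta q_gt0 dq dq1 dg dgd cq2 cgdd cc cd.
set Cr := Ccoef _ _ _ _ _ _ _ in cC; set Dr := Dcoef _ _ _ _ _ _ _ _ _ in cD.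
have CM : Mperiodic M Cr by move=> x; rewrite /Cr /Ccoef /dg1 /ctilde qM q1M q2M gM gdM cM.
have DM : Mperiodic M Dr.
  by move=> x; rewrite /Dr /Dcoef /dg1 /dg2 /ctilde qM q1M q2M gM gdM gddM cM dM.
have [B1 B1P] := Mperiodic_bounded M0 cC CM; have [B2 B2P] := Mperiodic_bounded M0 cD DM.
have B10 : 0 <= B1 := le_trans (normr_ge0 _) (B1P 0).
have B20 : 0 <= B2 := le_trans (normr_ge0 _) (B2P 0).
pose B := B1 + B2 + `|beta|.
have PC : Per M (fun x => (Cr x)%:C) by split; [exact: ccont_real | move=> x; rewrite CM].
have PD : Per M (fun x => (Dr x)%:C) by split; [exact: ccont_real | move=> x; rewrite DM].
have CB x : normc (Cr x)%:C <= B.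
  rewrite normc_real; apply: le_trans (B1P x) _.
  by rewrite /B -addrA lerDl addr_ge0.
have DB x : normc (Dr x)%:C <= B.
  rewrite normc_real; apply: le_trans (B2P x) _.
  by rewrite /B addrAC lerDr addr_ge0.
have bB : `|beta| <= B by rewrite /B lerDr addr_ge0.
have [k0 [K sol]] := large_frequency_solution M0 w_gt0 w_le w_cont wM dtheta theta0 PC PD CB DB bB.
exists P, beta, k0, K; split => //.
  rewrite bP (deltabarE M0 a0 (Ck_continuous (Ca 0%N)) (Ck_continuous Cb) dS) S0 subr0.
  by rewrite mulVKf// gt_eqF.
move=> n k kk0; have [k1 [h [y [z [m [Ph st zb mb]]]]]] := sol k kk0.
have EM x : cexp ('i * k%:C * (theta (x + M))%:C) = cexp ('i * k%:C * (theta x)%:C).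
  rewrite (thetaDM wM dtheta theta0) rmorphD mulrDr cexpD -/P.
  suff -> : cexp ('i * k%:C * P%:C) = 1 by rewrite mulr1.
  have kP : k * P = pi *+ 2 *+ n.
    by rewrite /k mulrAC divfK ?gt_eqF// mulr_natl mulr_natr.
  have -> : 'i * k%:C * P%:C = 0 +i* (pi *+ 2 *+ n) :> R[i].
    by rewrite -kP; apply: complex_eq; rewrite !ReImE /=; ring.
  have cs : cos (pi *+ 2 *+ n) = 1 :> R /\ sin (pi *+ 2 *+ n) = 0 :> R.
    elim: n {k kk0 k1 h y z m Ph st zb mb kP} => [|n [IHc IHs]]; first by rewrite mulr0n cos0 sin0.
    by rewrite mulrS (cosD (pi *+ 2)) (sinD (pi *+ 2)) IHc IHs cos2pi sin2pi; split; ring.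
  by rewrite /cexp /= expR0 !mul1r; case: cs => -> ->.
have e := eigenfunction M0 q_gt0 dq dq1 dg dgd dtheta dG cq2 cgdd cc cd a_def b_def Ph st zb GM G_gt0 EM.
eexists; split; first exact: e.
(* Since [i k^3] is imaginary, [lam.1 + beta * k ^+ 2] is exactly the real part of [m]. *)
apply: le_trans mb; apply: le_trans (normc_Re _) => /=.
rewrite le_eqVlt; apply/orP; left; apply/eqP; congr `|_|.
by rewrite -!rmorphXn !ReImE /=; ring.
Qed.

Theorem theorem5 (R : realType) (M : R) (a b c d : R -> R) :
  0 < M ->
  Csmooth a -> Csmooth b -> Csmooth c -> Csmooth d ->
  Mperiodic M a -> Mperiodic M b -> Mperiodic M c -> Mperiodic M d ->
  0 < inf (a @` `[0%R, M]) ->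
  deltabar M a b != 0 ->
  exists lam : nat -> R * R,
    (forall j, is_eigenvalue M a b c d (lam j)) /\
    (- deltabar M a b * (lam j).1) @[j --> \oo] --> +oo.
Proof.
move=> M0 sa sb sc sd aM bM cM dM ainf delta0.
have ca := Ck_continuous (Csmooth_Ck 0 sa).
have a0 x : 0 < a x.
  have [y y01 ->//] := Mperiodic_segment x M0.
  apply: lt_le_trans ainf _; apply: ge_inf; last by exists y.
  (* The infimum bounds [a] from below only if the image has a lower bound; the minimum of [a]
     provides one. *)
  have cna : continuous (fun x => - a x) by move=> t; apply: cvgN; exact: ca.
  have [|t tP] := Mperiodic_max M0 cna; first by move=> t; rewrite aM.
  by exists (a t) => _ [u _ <-]; rewrite -lerN2.
have [P [beta [k0 [K [P0 bP sol]]]]] := eigenvalue_asymptotics M0 a0 (fun n => Csmooth_Ck n sa)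
  (Csmooth_Ck 2 sb) (Ck_continuous (Csmooth_Ck 0 sc)) (Ck_continuous (Csmooth_Ck 0 sd)) aM bM cM dM.
set delta := deltabar M a b in delta0 bP *; clearbody delta.
pose t := 2 * pi / P; have t0 : 0 < t by rewrite divr_gt0// mulr_gt0// pi_gt0.
(* Shifting the index by [N] makes every frequency exceed [k0], so each [j] yields an eigenvalue. *)
pose N := Num.bound (`|k0| / t).
have kN j : k0 <= t * (N + j)%:R.
  apply: le_trans (ler_norm _) _; rewrite mulrC -ler_pdivrMr//.
  apply: ltW; apply: lt_le_trans (archi_boundP _) _; first by rewrite divr_ge0// ltW.
  by rewrite ler_nat leq_addr.
have /choice[lam lamP] := fun j => sol (N + j)%N (kN j).
exists lam; split; first by move=> j; have [] := lamP j.
(* As [beta = M * delta / P], the product is a positive multiple of [delta ^+ 2], whichever sign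
   [delta] has. *)
have db : 0 < delta * beta.
  have -> : delta * beta = M / P * delta ^+ 2.
    have -> : beta = M * delta / P by rewrite -bP mulfK// gt_eqF.
    by rewrite expr2; ring.
  by rewrite mulr_gt0 ?divr_gt0// exprn_even_gt0.
apply/cvgryPge => A.
pose L := `|delta| * K.
(* The lower bound to exploit is [(delta * beta * k - L) * k]: [N1] makes the bracket at least
   [|A| + 1], and [N2] makes [k] at least 1. *)
pose N1 := Num.bound ((`|L| + `|A| + 1) / (delta * beta) / t).
pose N2 := Num.bound (1 / t).
near=> j.
pose k := t * (N + j)%:R.
have k1 : 1 <= k.
  rewrite /k mulrC -ler_pdivrMr//; apply: ltW; apply: lt_le_trans (archi_boundP _) _.
    by rewrite divr_ge0// ltW.
  rewrite ler_nat; apply: leq_trans (leq_addl _ _); near: j; exact: nbhs_infty_ge.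
have k2 : `|L| + `|A| + 1 <= delta * beta * k.
  rewrite /k mulrA -ler_pdivrMl; last exact: mulr_gt0 db t0.
  have -> : (delta * beta * t)^-1 * (`|L| + `|A| + 1) = (`|L| + `|A| + 1) / (delta * beta) / t.
    by rewrite invfM mulrC !mulrA.
  apply: ltW; apply: lt_le_trans (archi_boundP _) _.
    by apply: divr_ge0 (ltW t0); apply: divr_ge0 (ltW db); rewrite !addr_ge0.
  rewrite ler_nat; apply: leq_trans (leq_addl _ _); near: j; exact: nbhs_infty_ge.
have [_ lb] := lamP j; rewrite -/t -/k in lb.
have l1 : - delta * (lam j).1 >= delta * beta * k ^+ 2 - L * k.
  have : `|delta * ((lam j).1 + beta * k ^+ 2)| <= L * k.
    by rewrite normrM /L -mulrA ler_wpM2l.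
  by move=> /(le_trans (ler_norm _)); lra.
apply: le_trans l1.
have LL := ler_norm L; have AA := ler_norm A; have A0 := normr_ge0 A.
rewrite expr2 mulrA -mulrBl.
apply: le_trans AA _; nra.
Unshelve. all: by end_near.
Qed.
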